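(* Let $X$ be a completely regular (Hausdorff) space whose topology is generated by a family of pseudometrics $\Pi$. Let $S\subset\mathcal{M}_r(X)$ be a set that is bounded in variation and uniformly tight. Then $S$ has compact closure in the topology $\tau_{KR}$. Moreover, if $S\subset\mathcal{M}_r^{\Pi}(X)$ and every pseudometric $p\in\Pi$ satisfies the condition of uniform integrability $$\lim_{R\to\infty}\sup_{\mu\in S}\int_{\{x\colon p(x,x_0)\ge R\}}p(x,x_0)\,|\mu|(dx)=0$$ for some $x_0\in X$, then $S$ is contained in a compact set in the topology $\tau_K$ (on $\mathcal{M}_r^\Pi(X)$).
   Context: A pseudometric is like a metric but may vanish on pairs of distinct points. A family $\Pi$ of pseudometrics generates the topology of $X$ if this is the coarsest topology for which all balls $\{y: p(x,y)<r\}$, $p\in\Pi$, are open. A finite nonnegative Borel measure $\mu$ is Radon if for every Borel set $B$ and $\varepsilon>0$ there is a compact $K\subset B$ with $\mu(B\setminus K)<\varepsilon$; a signed Borel measure is Radon if its total variation $|\mu|$ is. $\mathcal{M}_r(X)$ is the space of (signed) Radon measures. $\mathcal{M}_r^{\Pi}(X)$ is the subset of measures $\mu\in\mathcal{M}_r(X)$ such that $x\mapsto p(x,x_0)$ belongs to $L^1(|\mu|)$ for all $p\in\Pi$, for some (equivalently, every) $x_0\in X$. A set $M\subset\mathcal{M}_r(X)$ is uniformly tight if for every $\varepsilon>0$ there is a compact $K$ with $|\mu|(X\setminus K)<\varepsilon$ for all $\mu\in M$; it is bounded in variation if $\sup_{\mu\in M}|\mu|(X)<\infty$. For a pseudometric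 $p$, ${\rm Lip}_1(p)$ is the class of functions $f$ with $|f(x)-f(y)|\le p(x,y)$; $$\|\mu\|_{KR,p}=\sup\Bigl\{\int f\,d\mu\colon f\in{\rm Lip}_1(p),\ |f|\le1\Bigr\},\qquad \|\mu\|_{K,p}=\sup\Bigl\{\int f\,d\mu\colon f\in{\rm Lip}_1(p),\ f(x_0)=0\Bigr\}+|\mu(X)|.$$ The topology $\tau_{KR}$ on $\mathcal{M}_r(X)$ is generated by the seminorms $\|\cdot\|_{KR,p}$, $p\in\Pi$, and the topology $\tau_K$ on $\mathcal{M}_r^\Pi(X)$ by the seminorms $\|\cdot\|_{K,p}$, $p\in\Pi$. *)

(* Defs.v *)
From HB Require Import structures.
From mathcomp Require Import all_boot all_order all_algebra.
From mathcomp Require Import all_classical all_reals all_analysis.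

Set Implicit Arguments.
Unset Strict Implicit.
Unset Printing Implicit Defensive.

Import Order.TTheory GRing.Theory Num.Theory.
Import numFieldNormedType.Exports.

Local Open Scope classical_set_scope.
Local Open Scope ring_scope.

Section coarsest_topology.
Variable T : Type.
Implicit Types O B : set_system T.

Definition is_topology O : Prop :=
  [/\ O setT, setI_closed O &
      forall F : set_system T, F `<=` O -> O (\bigcup_(A in F) A)].

Definition coarsest_topology B : set_system T := smallest is_topology B.

Lemma is_topology_coarsest B : is_topology (coarsest_topology B).
Proof.
split; first by move=> O [[]].
- move=> U V BU BV O OB; have [[_ OI _] _] := OB.
  by apply: OI; [exact: BU|exact: BV].
- move=> F FB O OB; have [[_ _ OU] _] := OB.
  by apply: OU => A /FB; apply.
Qed.

End coarsest_topology.

(* T equipped with the coarsest topology in which the sets of B are open. *)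
Definition coarsest {T : Type} (B : set_system T) : Type := T.

Section coarsest_instance.
Variables (T : choiceType) (B : set_system T).

Let openT : coarsest_topology B setT.
Proof. by have [] := is_topology_coarsest B. Qed.

Let openI (U V : set (coarsest B)) : coarsest_topology B U ->
  coarsest_topology B V -> coarsest_topology B (U `&` V).
Proof. by have [_ + _] := is_topology_coarsest B; apply. Qed.

Let open_bigU (I : Type) (f : I -> set (coarsest B)) :
  (forall i, coarsest_topology B (f i)) -> coarsest_topology B (\bigcup_i f i).
Proof.
move=> fB; have [_ _ BU] := is_topology_coarsest B.
have -> : \bigcup_i f i = \bigcup_(A in range f) A by rewrite bigcup_image.
by apply: BU => _ [i _ <-].
Qed.

HB.instance Definition _ := Choice.on (coarsest B).
HB.instance Definition _ :=
  isOpenTopological.Build (coarsest B) openT openI open_bigU.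

End coarsest_instance.

Section pseudometrics.
Context {R : realType} {X : Type}.
Implicit Types (p : X -> X -> R) (Pi : set (X -> X -> R)).

Definition pseudometric p : Prop :=
  [/\ forall x y, 0 <= p x y,
      forall x, p x x = 0,
      forall x y, p x y = p y x &
      forall x y z, p x z <= p x y + p y z].

Definition pballs Pi : set_system X :=
  [set A | exists p x r, Pi p /\ A = [set y | p x y < r]].

Definition Lip1 p : set (X -> R) :=
  [set f | forall x y, `|f x - f y| <= p x y].

End pseudometrics.

Definition generates {R : realType} (X : topologicalType)
    (Pi : set (X -> X -> R)) : Prop :=
  @open X = coarsest_topology (pballs Pi).

Notation borel X := (g_sigma_algebraType (@open X)).

Section charges.
Context {R : realType} {d} {T : measurableType d}.
Implicit Types mu nu : {charge set T -> \bar R}.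

(* The Jordan decomposition does not depend on the Hahn decomposition chosen
   (see Hahn_decomposition_uniq). *)
Lemma hahn_pair_subproof mu :
  {PN : set T * set T | hahn_decomposition mu PN.1 PN.2}.
Proof.
by apply: cid; have [P [N PN]] := Hahn_decomposition mu; exists (P, N).
Qed.

Definition hahn_pair mu := sval (hahn_pair_subproof mu).

Definition hahn_pairP mu :
    hahn_decomposition mu (hahn_pair mu).1 (hahn_pair mu).2 :=
  svalP (hahn_pair_subproof mu).

Definition variation_measure mu : {measure set T -> \bar R} :=
  charge_variation (hahn_pairP mu).

Local Open Scope ereal_scope.

(* Only meaningful when f is integrable for variation_measure mu. *)
Definition charge_integral mu (f : T -> R) : \bar R :=
  \int[jordan_pos (hahn_pairP mu)]_x (f x)%:E -
  \int[jordan_neg (hahn_pairP mu)]_x (f x)%:E.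

Definition csub mu nu : {charge set T -> \bar R} := cadd mu (copp nu).

End charges.

Definition radon {R : realType} {X : ptopologicalType}
    (m : set (borel X) -> \bar R) : Prop :=
  forall B : set X, @measurable _ (borel X) B ->
  forall e : R, 0 < e ->
  exists K : set X, [/\ compact K, K `<=` B & (m (B `\` K) < e%:E)%E].

(* M_r(X). As everywhere in the library, a charge also takes irrelevant values
   on nonmeasurable sets; two charges that agree on the Borel sets are at
   distance 0 for all the seminorms below, hence topologically
   indistinguishable. *)
Record radon_measure (R : realType) (X : ptopologicalType) := RadonMeasure {
  radon_charge :> {charge set (borel X) -> \bar R} ;
  radon_measureP : radon (variation_measure radon_charge) }.

HB.instance Definition _ (R : realType) (X : ptopologicalType) :=
  gen_eqMixin (radon_measure R X).
HB.instance Definition _ (R : realType) (X : ptopologicalType) :=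
  gen_choiceMixin (radon_measure R X).

Section kantorovich.
Context {R : realType} {X : ptopologicalType}.
Implicit Types (p : X -> X -> R) (Pi : set (X -> X -> R)).
Implicit Types (x : X) (mu : radon_measure R X).
Implicit Types (S : set (radon_measure R X)).
Local Open Scope ereal_scope.

Definition bounded_in_variation S : Prop :=
  ereal_sup [set variation_measure mu setT | mu in S] < +oo.

Definition uniformly_tight S : Prop :=
  forall e : R, (0 < e)%R -> exists2 K : set X, compact K &
    forall mu, S mu -> variation_measure mu (~` K) < e%:E.

(* M_r^Pi(X) *)
Definition radon_Pi Pi : set (radon_measure R X) :=
  [set mu | exists x0, forall p, Pi p ->
    (variation_measure mu).-integrable setT (fun x : borel X => (p x x0)%:E)].

(* The supremum is taken in [0, +oo], so that it is 0 when S is empty. *)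
Definition uniformly_integrable_at S p (x0 : X) : Prop :=
  (fun r : R => ereal_sup (0 |`
    [set \int[variation_measure mu]_(x in [set x | (r <= p x x0)%R]) (p x x0)%:E
    | mu in S])) @ +oo%R --> 0.

Definition KR_norm p (nu : {charge set (borel X) -> \bar R}) : \bar R :=
  ereal_sup [set charge_integral nu f | f in
    [set f | Lip1 p f /\ forall x, (`|f x| <= 1)%R]].

Definition K_norm (x0 : X) p (nu : {charge set (borel X) -> \bar R}) : \bar R :=
  ereal_sup [set charge_integral nu f | f in
    [set f | Lip1 p f /\ f x0 = 0%R]] + `|nu setT|.

Definition tau_KR Pi : topologicalType :=
  @coarsest (radon_measure R X)
    [set A | exists p mu (r : R), Pi p /\
      A = [set nu : radon_measure R X | KR_norm p (csub nu mu) < r%:E]].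

Definition tau_K Pi (x0 : X) : topologicalType :=
  @coarsest (radon_Pi Pi)
    [set A | exists p (mu : radon_Pi Pi) (r : R), Pi p /\
      A = [set nu : radon_Pi Pi |
             K_norm x0 p (csub (val nu) (val mu)) < r%:E]].

End kantorovich.

(* Main.v *)
(* By tightness and bounded variation, an ultrafilter on S has limits separately
   on the positive and the negative Jordan parts: the limiting masses of open
   sets form a tight content, whose inner-regularized outer measure is a Radon
   measure, and slicing functions into superlevel sets gives convergence of the
   integrals of bounded continuous functions. On a compact set carrying most of
   all the masses, a p-Lipschitz function is close to its interpolation by
   finitely many continuous bumps, the same for all functions of the class, so
   convergence is uniform on {f in Lip1 p, |f| <= 1}; truncation and uniform
   integrability extend this to {f in Lip1 p, f x0 = 0}. Both topologies are
   regular, so convergence of the ultrafilters on S makes its closure compact. *)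
Require Import Defs.
From HB Require Import structures.
From mathcomp Require Import all_boot all_order all_algebra.
From mathcomp Require Import all_classical all_reals all_analysis.
From mathcomp Require Import measurable_realfun ring lra.
Import Order.TTheory GRing.Theory Num.Theory.
Import numFieldNormedType.Exports.
Local Open Scope classical_set_scope.
Local Open Scope ring_scope.

Set Implicit Arguments.
Unset Strict Implicit.

(** * Topologies generated by gauges *)

(** A limit of masses along an ultrafilter is in general only finitely additive, and mass may drift
    onto the boundary of an open set. The Radon limit [nu] therefore satisfies only [nu G <= lam G]
    on open sets, with equality on the whole space; these two facts suffice for weak convergence.
    The Jordan decomposition is not continuous: the limits [a] and [b] of the positive and negative
    parts need not be mutually singular, so the Jordan parts of [a - b] can be strictly smaller, and
    the difference of two charges has yet another decomposition. Integrals against a charge are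
    therefore computed through arbitrary representations as differences of finite positive measures.
    Both topologies come from one estimate for functions dominated by an envelope [h]: the constant
    1 for the first, [p x x0] for the second. Uniform integrability is used as smallness of the
    integrals of [Num.max (h x - T) 0], which, unlike the restriction of [h] to the set where
    [h >= T], is continuous and so survives weak limits. *)

Lemma coarsest_nbhs (T : choiceType) (B : set_system T) (F : set_system T)
    (y : coarsest B) :
  Filter F -> (forall A, B A -> A y -> F A) -> F --> y.
Proof.
(* The sets [A] with [A y -> F A] form a topology; once it contains [B], it contains every open set,
   so only subbasic neighbourhoods need testing. *)
move=> FF BF; suff OF : coarsest_topology B `<=` [set A | A y -> F A].
  move=> A; rewrite nbhsE/= => -[U [oU Uy] UA].
  exact: filterS UA (OF _ oU Uy).
apply: smallest_sub => //=; split.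
- by move=> _; exact: filterT.
- by move=> U V FU FV [Uy Vy]; apply: filterI; [exact: FU|exact: FV].
- move=> G GF [A GA Ay]; apply: filterS (GF _ GA Ay).
  exact: bigcup_sup.
Qed.

Lemma coarsest_open (T : choiceType) (B : set_system T) (A : set (coarsest B)) :
  B A -> open A.
Proof. exact: (@sub_gen_smallest _ (@is_topology T) B). Qed.

(* The topology is regular, so it is enough to test ultrafilters on S instead of
   ultrafilters on its closure. *)
Lemma gauge_compact_closure (R : realType) (T : choiceType)
    (P : set (T -> T -> \bar R)) (S : set T) :
  let B := [set A | exists d x (r : R),
    P d /\ A = [set y | (d y x < r%:E)%E]] in
  (forall d, P d -> [/\ forall x y, (0 <= d x y)%E, forall x, d x x = 0%E,
    forall x y, d x y = d y x & forall x y z, (d x z <= d x y + d y z)%E]) ->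
  (forall F : set_system T, UltraFilter F -> F S -> exists y, forall d, P d ->
    forall e : R, 0 < e -> F [set x | (d x y < e%:E)%E]) ->
  compact (closure (S : set (coarsest B))).
Proof.
move=> B Pd cvgS; rewrite compact_ultra => F FU FS /=.
(* The traces on [S] of the open members of [F] are nonempty because [F] contains the closure of
   [S]. An ultrafilter [H] finer than [G] lives on [S], so the hypothesis gives it a limit [y],
   which turns out to be a limit of [F] too. *)
pose G := filter_from (fun U => open (U : set (coarsest B)) /\ F U)
  (fun U => S `&` U).
have FG : ProperFilter G.
  apply: filter_from_proper.
    apply: filter_from_filter.
      by exists setT; split; [exact: openT|exact: filterT].
    move=> U V [oU FU'] [oV FV]; exists (U `&` V).
      by split; [exact: openI|exact: filterI].
    by move=> x [Sx [Ux Vx]].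
  move=> U [oU FU'].
  have [x [clSx Ux]] : (closure (S : set (coarsest B)) `&` U) !=set0.
    apply: (@filter_ex T F _); exact: (@filterI T F).
  by apply: clSx; exact: open_nbhs_nbhs.
have [H [HU GH]] := ultraFilterLemma FG.
have HS : H S by apply: GH; exists setT => //; split;
  [exact: openT|exact: filterT].
have [y Hy] := cvgS H HU HS.
have Fy : F --> (y : coarsest B).
  apply: coarsest_nbhs => _ [d [z [r [Pdd ->]]]] /= yz.
  have [d0 dxx dC dtri] := Pd _ Pdd.
  have dyz : d y z \is a fin_num by rewrite ge0_fin_numE// (lt_trans yz)// ltry.
  pose e := r - fine (d y z).
  have e0 : 0 < e by rewrite subr_gt0 -lte_fin fineK.
  suff : F [set x | (d x y < e%:E)%E].
    apply: filterS => x /= xy; apply: (le_lt_trans (dtri x y z)).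
    by rewrite -lteBrDr// -(fineK dyz) -EFinB.
  (* If the ball of radius [e] is not in [F], its complement is, and so is the larger open set [V]
     outside radius [e / 2]. Openness puts the trace of [V] in [G], hence in [H], although [H] is
     eventually within [e / 2] of [y]. *)
  have [//|Fn] := in_ultra_setVsetC [set x | (d x y < e%:E)%E] FU.
  pose V := [set w | ((e / 2)%:E < d w y)%E].
  have FV : F V.
    apply: filterS Fn => x /=; rewrite /V/= => /negP; rewrite -leNgt.
    by apply: lt_le_trans; rewrite lte_fin; lra.
  have oV : open (V : set (coarsest B)).
    rewrite openE => w Vw /=; rewrite /interior.
    (* Gauges may be infinite: then any radius works; otherwise half of the slack [s - e / 2]
       does. *)
    have [c c0 wc] : exists2 c : R, 0 < c & ((e / 2 + c)%:E < d w y)%E.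
      move: Vw; rewrite /V /=; case: (d w y) => [s| |]//.
        rewrite lte_fin => es; exists ((s - e / 2) / 2); first lra.
        by rewrite lte_fin; lra.
      by move=> _; exists 1 => //; exact: ltry.
    have : nbhs (w : coarsest B) [set u | (d u w < c%:E)%E].
      apply: open_nbhs_nbhs; split; last by rewrite /= dxx lte_fin.
      by apply: coarsest_open; exists d, w, c.
    apply: filterS => u /= uw; rewrite /V/= ltNge; apply/negP => uy.
    have := dtri w u y; rewrite leNgt => /negP; apply.
    rewrite dC (le_lt_trans (leeD (ltW uw) uy))// -EFinD.
    by rewrite [(_ + _)%R]addrC.
  have HV : H (S `&` V) by apply: GH; exists V.
  have e20 : 0 < e / 2 by lra.
  have [x [[_ /=]]] := @filter_ex _ H _ _ (filterI HV (Hy _ Pdd _ e20)).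
  by rewrite /V/= => /lt_trans /[apply]; rewrite ltxx.
exists y; split => //; apply: closed_closure => U Uy.
exact: (@filter_ex T F _ _ (filterI FS (Fy _ Uy))).
Qed.

(** * Radon measures from tight contents *)

(** Being outside [closure W] is an open condition on the point that persists when [W] shrinks, so
    the near-covering form of compactness makes the local choices uniform. Applied first to
    [nbhs x], then to [set_nbhs L], it separates two compact sets. *)
Lemma compact_disjoint_closure (X : topologicalType) (K : set X)
    (F : set_system X) : Filter F -> compact K ->
  (forall x, K x -> exists2 U, nbhs x U & F (~` U)) ->
  exists2 W, F W & K `<=` ~` closure W.
Proof.
move=> FF /compact_near_coveringP Kc KF.
pose G := filter_from F (fun W => [set V : set X | V `<=` W]).
have GF : Filter G.
  apply: filter_from_filter; first by exists setT; exact: filterT.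
  move=> A B FA FB; exists (A `&` B); first exact: filterI.
  by move=> V /= VAB; split=> x /VAB[].
have := Kc _ G (fun W x => ~ closure W x) GF.
case.
  move=> x Kx; have [U xU FU] := KF _ Kx.
  move: xU; rewrite nbhsE => -[V [oV Vx] VU].
  exists (V, [set W | W `<=` ~` V]) => /=.
    split; first exact: open_nbhs_nbhs.
    exists (~` V) => //; apply: filterS FU; exact: subsetC.
  move=> -[y W]/= [Vy WV] /(_ V) [|z [/WV]]//.
  exact: open_nbhs_nbhs.
by move=> W FW WK; exists W => // x Kx; apply: (WK W).
Qed.

Lemma compact_separation (X : topologicalType) (K L : set X) :
  hausdorff_space X -> compact K -> compact L -> K `&` L = set0 ->
  exists U V, [/\ open U, open V, K `<=` U, L `<=` V & U `&` V = set0].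
Proof.
rewrite open_hausdorff => hX Kc Lc KL0.
have KL x : K x -> exists2 U, nbhs x U & set_nbhs L (~` U).
  move=> Kx; have [y Ly|V xV LV] := @compact_disjoint_closure _ L (nbhs x) _ Lc.
    have yx : y != x.
      by apply: contraPneq Ly => -> Lx; have : set0 x by rewrite -KL0.
    have [[A B]/= [/set_mem Ay /set_mem Bx] [oA oB /eqP AB0]] := hX _ _ yx.
    exists A; first exact: open_nbhs_nbhs.
    have : nbhs x B by exact: open_nbhs_nbhs.
    by apply: filterS => z Bz Az; have : set0 z by rewrite -AB0.
  exists V => //; apply/set_nbhsP; exists (~` closure V); split => //.
    exact/closed_openC/closed_closure.
  exact/subsetC/subset_closure.
have [W /set_nbhsP[V [oV LV VW]] KW] := compact_disjoint_closure _ Kc KL.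
exists (~` closure W), V; split => //; first exact/closed_openC/closed_closure.
rewrite setIC; apply/disjoints_subset; rewrite setCK.
exact: subset_trans (@subset_closure _ W).
Qed.

(** [K] minus [G] and [K] minus [H] are disjoint compact sets; removing disjoint neighbourhoods [U],
    [V] of them from [K] gives the two pieces, which cover [K] because [U] and [V] do not meet. *)
Lemma compact_split (X : topologicalType) (K G H : set X) :
  hausdorff_space X -> compact K -> open G -> open H -> K `<=` G `|` H ->
  exists L M, [/\ compact L, compact M, L `<=` G, M `<=` H & K = L `|` M].
Proof.
move=> hX Kc oG oH KGH.
have [|||U [V [oU oV KU KV UV0]]] :=
  @compact_separation _ (K `&` ~` G) (K `&` ~` H) hX.
- by apply: compact_closedI => //; exact: open_closedC.
- by apply: compact_closedI => //; exact: open_closedC.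
- rewrite -subset0 => x [[Kx nGx] [_ nHx]].
  by case: (KGH x Kx).
exists (K `&` ~` U), (K `&` ~` V); split.
- by apply: compact_closedI => //; exact: open_closedC.
- by apply: compact_closedI => //; exact: open_closedC.
- by move=> x [Kx nUx]; apply: contrapT => nGx; apply: nUx; exact: KU.
- by move=> x [Kx nVx]; apply: contrapT => nHx; apply: nVx; exact: KV.
- by rewrite -setIUr -setCI UV0 setC0 setIT.
Qed.

Section content_extension.
Context {R : realType} {X : ptopologicalType}.
Variable lam : set X -> R.
Hypothesis X_hausdorff : hausdorff_space X.
Hypothesis lam0 : lam set0 = 0.
Hypothesis lam_ge0 : forall G, open G -> 0 <= lam G.
Hypothesis lam_le : forall G H, open G -> open H -> G `<=` H -> lam G <= lam H.
Hypothesis lamU : forall G H, open G -> open H ->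
  lam (G `|` H) <= lam G + lam H.
Hypothesis lamDU : forall G H, open G -> open H -> G `&` H = set0 ->
  lam G + lam H <= lam (G `|` H).
Hypothesis lam_tight : forall e : R, 0 < e ->
  exists2 K, compact K & lam (~` K) <= e.
Implicit Types A G K : set X.
Local Open Scope ereal_scope.

(** [lam] is only finitely subadditive. Going down to compact sets and back up to open sets gains
    countable subadditivity, since a compact subset of a countable union of open sets meets only a
    finite subcover. *)
Definition compact_capacity K : \bar R :=
  ereal_inf [set (lam G)%:E | G in [set G | open G /\ K `<=` G]].

Definition inner_capacity G : \bar R :=
  ereal_sup [set compact_capacity K | K in [set K | compact K /\ K `<=` G]].

Definition outer_capacity A : \bar R :=
  ereal_inf [set inner_capacity G | G in [set G | open G /\ A `<=` G]].

Local Notation kap := compact_capacity.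
Local Notation icap := inner_capacity.
Local Notation ocap := outer_capacity.

Let kap_le K G : open G -> K `<=` G -> kap K <= (lam G)%:E.
Proof. by move=> oG KG; apply: ereal_inf_lbound; exists G. Qed.

Let kap_ge0 K : 0 <= kap K.
Proof.
by apply: le_ereal_inf_tmp => _ [G [oG _] <-]; rewrite lee_fin lam_ge0.
Qed.

Let kap0 : kap set0 = 0.
Proof.
apply/eqP; rewrite eq_le kap_ge0 andbT.
by apply: le_trans (kap_le open0 _) _ => //; rewrite lam0.
Qed.

Let kap_fin K : kap K \is a fin_num.
Proof.
rewrite ge0_fin_numE ?kap_ge0// (le_lt_trans (kap_le openT _))//.
exact: ltry.
Qed.

Let kapU K L : kap (K `|` L) <= kap K + kap L.
Proof.
apply/lee_addgt0Pr => e e0.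
have e20 : (0 < e / 2)%R by rewrite divr_gt0.
have [_ [G [oG KG] <-] Ge] := lb_ereal_inf_adherent e20 (kap_fin K).
have [_ [H [oH LH] <-] He] := lb_ereal_inf_adherent e20 (kap_fin L).
apply: (@le_trans _ _ (lam (G `|` H))%:E).
  by apply: kap_le; [exact: openU|exact: setUSS].
apply: (@le_trans _ _ ((lam G)%:E + (lam H)%:E)).
  by rewrite -EFinD lee_fin lamU.
rewrite (splitr e) EFinD addeACA; exact: leeD (ltW Ge) (ltW He).
Qed.

Let kapDU K L : compact K -> compact L -> K `&` L = set0 ->
  kap K + kap L <= kap (K `|` L).
Proof.
move=> Kc Lc KL0; apply: le_ereal_inf_tmp => _ [G [oG KLG] <-].
have [U [V [oU oV KU LV UV0]]] := compact_separation X_hausdorff Kc Lc KL0.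
have oGU : open (G `&` U) by exact: openI.
have oGV : open (G `&` V) by exact: openI.
apply: (@le_trans _ _ ((lam (G `&` U))%:E + (lam (G `&` V))%:E)).
  apply: leeD; apply: kap_le => // x.
    by move=> Kx; split; [apply: KLG; left|exact: KU].
  by move=> Lx; split; [apply: KLG; right|exact: LV].
rewrite -EFinD lee_fin (le_trans (lamDU oGU oGV _))//.
  by rewrite setIACA UV0 setI0.
by apply: lam_le => //; [exact: openU|rewrite -setIUr; exact: subIsetl].
Qed.

Let icap_ge0 G : 0 <= icap G.
Proof.
rewrite -kap0; apply: ereal_sup_ubound; exists set0 => //.
by split => //; exact: compact0.
Qed.

Let kap_icap K G : compact K -> K `<=` G -> kap K <= icap G.
Proof. by move=> Kc KG; apply: ereal_sup_ubound; exists K. Qed.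

Let icap_le G H : G `<=` H -> icap G <= icap H.
Proof.
move=> GH; apply: ge_ereal_sup => _ [K [Kc KG] <-].
by apply: kap_icap => //; exact: subset_trans GH.
Qed.

Let icap_lam G : open G -> icap G <= (lam G)%:E.
Proof. by move=> oG; apply: ge_ereal_sup => _ [K [Kc KG] <-]; exact: kap_le. Qed.

Let icap_fin G : icap G \is a fin_num.
Proof.
rewrite ge0_fin_numE// (le_lt_trans (icap_le (@subsetT _ _)))//.
by rewrite (le_lt_trans (icap_lam openT))// ltry.
Qed.

(** Induction on [n]: [compact_split] cuts off the part of [K] inside the last open set. *)
Let kap_bigsetU (G : (set X)^nat) n K : (forall i, open (G i)) -> compact K ->
  K `<=` \big[setU/set0]_(i < n) G i -> kap K <= \sum_(i < n) icap (G i).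
Proof.
move=> oG; elim: n K => [|n IH] K Kc.
  by rewrite !big_ord0 subset0 => ->; rewrite kap0.
rewrite !big_ord_recr/= => KG.
have oGn : open (\big[setU/set0]_(i < n) G i).
  by rewrite -bigcup_mkord; exact: bigcup_open.
have [L [M [Lc Mc LG MG ->]]] := compact_split X_hausdorff Kc oGn (oG n) KG.
by rewrite (le_trans (kapU _ _))// leeD ?IH// kap_icap.
Qed.

Let icap_bigcup (G : (set X)^nat) : (forall i, open (G i)) ->
  icap (\bigcup_i G i) <= \sum_(i <oo) icap (G i).
Proof.
move=> oG; apply: ge_ereal_sup => _ [K [Kc KG] <-].
move: (Kc); rewrite compact_cover => /(_ nat setT G (fun i _ => oG i) KG)[D _ KD].
pose n := (\max_(i <- finmap.enum_fset D) i).+1%N.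
apply: (@le_trans _ _ (\sum_(i < n) icap (G i))).
  apply: kap_bigsetU => // x /KD[i /= iD Gix].
  rewrite -bigcup_mkord; exists i => //=.
  by rewrite /n ltnS; exact: (@leq_bigmax_seq _ (finmap.enum_fset D) xpredT id i).
rewrite -(big_mkord xpredT (icap \o G)).
by apply: (@nneseries_lim_ge _ _ xpredT 0%N n) => k _ _; exact: icap_ge0.
Qed.

Let ocap_open G : open G -> ocap G = icap G.
Proof.
move=> oG; apply/eqP; rewrite eq_le; apply/andP; split.
  by apply: ereal_inf_lbound; exists G => //; split.
by apply: le_ereal_inf_tmp => _ [H [oH GH] <-]; exact: icap_le.
Qed.

Let ocap0 : ocap set0 = 0.
Proof.
rewrite ocap_open; last exact: open0.
by apply/eqP; rewrite eq_le icap_ge0 andbT (le_trans (icap_lam open0))// lam0.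
Qed.

Let ocap_ge0 A : 0 <= ocap A.
Proof. by apply: le_ereal_inf_tmp => _ [G _ <-]. Qed.

Let ocap_le : {homo ocap : A B / A `<=` B >-> A <= B}.
Proof.
move=> A B AB; apply: ereal_inf_le_tmp => _ [G [oG BG] <-].
by exists G => //; split => //; exact: subset_trans BG.
Qed.

Let ocap_fin A : ocap A \is a fin_num.
Proof.
rewrite ge0_fin_numE// (le_lt_trans (ocap_le (@subsetT _ _)))//.
by rewrite ocap_open ?ltey_eq ?icap_fin//; exact: openT.
Qed.

Let ocap_sigma_subadditive : sigma_subadditive ocap.
Proof.
move=> F; apply/lee_addgt0Pr => e e0.
apply: le_trans (epsilon_trick _ _ _) => //=; last exact: ltW.
have eVn_gt0 n : (0 < e / (2 ^ n.+1)%:R)%R by rewrite divr_gt0// ltr0n expn_gt0.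
have /choice[G FG] : forall n, exists G, [/\ open G, F n `<=` G &
    icap G <= ocap (F n) + (e / (2 ^ n.+1)%:R)%:E].
  move=> n; have [_ [G [oG FG] <-] /ltW] :=
    lb_ereal_inf_adherent (eVn_gt0 n) (ocap_fin (F n)).
  by exists G.
have oG n : open (G n) by have [] := FG n.
apply: (@le_trans _ _ (icap (\bigcup_n G n))).
  rewrite -ocap_open; last exact: bigcup_open.
  by apply: ocap_le; apply: subset_bigcup => n _; have [] := FG n.
apply: (le_trans (icap_bigcup oG)); apply: lee_nneseries => // n _ .
by have [] := FG n.
Qed.

HB.instance Definition _ := isOuterMeasure.Build R X ocap
  ocap0 ocap_ge0 ocap_le ocap_sigma_subadditive.

(** Replace [A] by an open [V] containing it, exhaust [V] inside [G] by a compact [K] up to [e / 2],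
    then exhaust [V] minus [K], which contains [V] minus [G], by a compact [L]. [K] and [L] are
    disjoint, so their capacities add up below that of [V]. *)
Let ocap_caratheodory G : open G -> ocap.-caratheodory G.
Proof.
move=> oG; apply: le_caratheodory_measurable => A.
apply: le_ereal_inf_tmp => _ [V [oV AV] <-].
apply: (@le_trans _ _ (icap (V `&` G) + ocap (V `&` ~` G))).
  rewrite -ocap_open; last exact: openI.
  by apply: leeD; apply: ocap_le; exact: setSI.
apply/lee_addgt0Pr => e e0.
have e20 : (0 < e / 2)%R by rewrite divr_gt0.
have [_ [K [Kc KVG] <-] Ke] := ub_ereal_sup_adherent e20 (icap_fin (V `&` G)).
have oVK : open (V `&` ~` K).
  by apply: openI => //; apply: closed_openC; exact: compact_closed.
have [_ [L [Lc LVK] <-] Le] := ub_ereal_sup_adherent e20 (icap_fin (V `&` ~` K)).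
have VGK : ocap (V `&` ~` G) <= icap (V `&` ~` K).
  rewrite -ocap_open//; apply: ocap_le; apply: setIS; apply: subsetC.
  by move=> x /KVG[].
have KL0 : K `&` L = set0 by rewrite -subset0 => x [Kx /LVK[]].
apply: (@le_trans _ _ (kap (K `|` L) + e%:E)).
  apply: le_trans (leeD (kapDU Kc Lc KL0) (lexx _)).
  rewrite (splitr e) EFinD addeACA; apply: leeD; rewrite -leeBlDr//.
    exact: ltW.
  by apply: le_trans (ltW Le); rewrite leeB.
apply: leeD => //; apply: kap_icap; first exact: compactU.
by move=> x [/KVG[]|/LVK[]].
Qed.

Let borel_caratheodory :
  @measurable _ (borel X) `<=` ocap.-caratheodory.
Proof.
apply: smallest_sub => [|G oG]; last exact: ocap_caratheodory.
exact: (@sigma_algebra_measurable _ (caratheodory_type ocap)).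
Qed.

Definition capacity_measure (A : set (borel X)) : \bar R := ocap A.
Local Notation nu := capacity_measure.

Let nu_sigma_additive : semi_sigma_additive nu.
Proof.
move=> F mF tF mUF.
by apply: (@caratheodory_measure_sigma_additive R X ocap) => //;
  [move=> i|]; exact: borel_caratheodory.
Qed.

HB.instance Definition _ := isMeasure.Build _ (borel X) R nu
  ocap0 ocap_ge0 nu_sigma_additive.

Let nu_fin : fin_num_fun nu. Proof. by move=> A _; exact: ocap_fin. Qed.

HB.instance Definition _ := Measure_isFinite.Build _ (borel X) R nu nu_fin.

Lemma content_radon_measure : exists m : {finite_measure set (borel X) -> \bar R},
  [/\ radon m, forall G, open G -> m G <= (lam G)%:E & m setT = (lam setT)%:E].
Proof.
exists nu.
have nu_le G : open G -> nu G <= (lam G)%:E.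
  by move=> oG; rewrite /capacity_measure ocap_open// icap_lam.
split => //.
- move=> B mB e e0; have e20 : (0 < e / 2)%R by rewrite divr_gt0.
  have [_ [G [oG BG] <-] Ge] := lb_ereal_inf_adherent e20 (ocap_fin (~` B)).
  have e40 : (0 < e / 4)%R by rewrite divr_gt0.
  have [K Kc Ke] := lam_tight e40.
  have oK : open (~` K) by apply: closed_openC; exact: compact_closed.
  have mo H : open H -> measurable (H : set (borel X)).
    exact: sub_sigma_algebra.
  have GB : ~` G `<=` B by rewrite -(setCK B); exact: subsetC.
  (* [G] is a nearly optimal open cover of the complement of [B], so what is lost from [B] lies
     either in the small excess of [G] over that complement or outside [K]. *)
  exists (K `&` ~` G); split.
  + by apply: compact_closedI => //; exact: open_closedC.
  + by move=> x [_ /GB].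
  + have sub : B `\` (K `&` ~` G) `<=` (G `\` ~` B) `|` ~` K.
      move=> x [Bx nKG]; have [Kx|] := pselect (K x); last by right.
      by left; split; [apply: contrapT => nG; apply: nKG|move=> /(_ Bx)].
    rewrite (le_lt_trans (ocap_le sub))//.
    rewrite (le_lt_trans (outer_measureU2 _ _ _))//.
    have GBe : nu (G `\` ~` B) < (e / 2)%:E.
      rewrite measureD//=; last 3 first.
      * exact: mo.
      * exact: measurableC.
      * by rewrite -ge0_fin_numE//; exact: ocap_fin.
      have /setIidPr -> := BG.
      rewrite lteBlDr; last exact: ocap_fin.
      by rewrite addeC {1}/capacity_measure ocap_open.
    rewrite (splitr e) EFinD lte_leD//.
    rewrite (le_trans (nu_le _ oK))// lee_fin (le_trans Ke)//; lra.
- apply/eqP; rewrite eq_le nu_le/=; last exact: openT.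
  rewrite /capacity_measure ocap_open; last exact: openT.
  apply/lee_addgt0Pr => e e0; have [K Kc Ke] := lam_tight e0.
  (* Any open [G] containing [K] covers the space together with the complement of [K], whence
     [lam G >= lam setT - e]: tightness prevents a loss of total mass. *)
  rewrite -leeBlDr//; apply: le_trans (kap_icap Kc (@subsetT _ _)).
  apply: le_ereal_inf_tmp => _ [G [oG KG] <-].
  have oK : open (~` K) by apply: closed_openC; exact: compact_closed.
  rewrite -EFinB lee_fin lerBlDr (@le_trans _ _ (lam G + lam (~` K))%R)//.
    apply: le_trans (lamU oG oK); apply: lam_le; [exact: openT|exact: openU|].
    by move=> x _; have [/KG|] := pselect (K x); [left|right].
  by rewrite lerD2l.
Qed.

End content_extension.

(** * Weak limits of positive measures *)

Lemma ultra_cvg_segment (R : realType) (I : Type) (F : set_system I)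
    (f : I -> R) (a b : R) : UltraFilter F ->
  (\forall i \near F, a <= f i <= b) -> cvg (f @ F).
Proof.
move=> FU fab.
have [l [_ fl]] := @segment_compact R a b (f @ F) _ fab.
apply/cvg_ex; exists l => U lU.
have [//|FnU] := in_ultra_setVsetC (f @^-1` U) FU.
by have [x []] := fl (~` U) U FnU lU.
Qed.

Lemma cvgr_le_limit (R : realFieldType) (I : Type) (F : set_system I)
    {FF : ProperFilter F} (f g : I -> R) (a b : R) :
  f @ F --> a -> g @ F --> b -> (\forall i \near F, f i <= g i) -> a <= b.
Proof.
move=> fa gb fg; rewrite -subr_ge0.
have gfab : (g i - f i) @[i --> F] --> b - a by exact: cvgB.
rewrite -(cvg_lim _ gfab)//; apply: limr_ge; first exact: cvgP gfab.
by apply: filterS fg => i; rewrite subr_ge0.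
Qed.

Section ultra_limit.
Context {R : realType} {X : ptopologicalType} {I : Type} (F : set_system I).
Context {FU : UltraFilter F}.
Variable m : I -> {finite_measure set (borel X) -> \bar R}.
Implicit Types G H : set X.

Let mopen G : open G -> @measurable _ (borel X) G.
Proof. exact: sub_sigma_algebra. Qed.

(** Bounded masses converge along an ultrafilter, so [lam] is defined on all open sets at once and
    inherits the finite (sub)additivity of the [m i]. The estimate on open sets is one-sided, as in
    the portmanteau theorem. *)
Lemma ultra_limit_radon_measure (C : R) : hausdorff_space X ->
  (\forall i \near F, (m i setT <= C%:E)%E) ->
  (forall e : R, 0 < e -> exists2 K : set X, compact K &
    \forall i \near F, (m i (~` K) <= e%:E)%E) ->
  exists nu : {finite_measure set (borel X) -> \bar R}, [/\ radon nu,
    forall G, open G -> forall e : R, 0 < e ->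
      \forall i \near F, fine (nu G) <= fine (m i G) + e &
    fine (m i setT) @[i --> F] --> fine (nu setT)].
Proof.
move=> hX mC mtight.
pose lam G := lim (fine (m i G) @[i --> F]).
have mfin i A : @measurable _ (borel X) A -> m i A \is a fin_num.
  by move=> mA; exact: fin_num_measure.
have mle i A B : @measurable _ (borel X) A -> @measurable _ (borel X) B ->
    A `<=` B -> fine (m i A) <= fine (m i B).
  by move=> mA mB AB; rewrite fine_le ?mfin// le_measure ?inE.
have cvgm G : open G -> fine (m i G) @[i --> F] --> lam G.
  move=> oG; apply: (@ultra_cvg_segment _ _ _ _ 0 C).
  apply: filterS mC => i miC; rewrite fine_ge0//=.
  rewrite -lee_fin fineK ?mfin//; last exact: mopen.
  by apply: le_trans miC; rewrite le_measure ?inE//; exact: mopen.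
have [||||||nu [rnu nule nuT]] := @content_radon_measure R X lam hX.
- rewrite /lam (_ : (fun i => _) = cst 0); last first.
    by apply/funext => i; rewrite measure0.
  by apply: cvg_lim => //; exact: cvg_cst.
- move=> G oG; apply: limr_ge; first by apply: cvgP; exact: cvgm.
  by apply: nearW => i; rewrite fine_ge0.
- move=> G H oG oH GH; apply: cvgr_le_limit (cvgm _ oG) (cvgm _ oH) _.
  by apply: nearW => i; apply: mle => //; exact: mopen.
- move=> G H oG oH; have [mG mH] := (mopen oG, mopen oH).
  apply: (cvgr_le_limit (cvgm _ (openU oG oH)) (cvgD (cvgm _ oG) (cvgm _ oH))).
  apply: nearW => i; rewrite /GRing.add/= -fineD ?mfin//.
  by rewrite fine_le ?fin_numD ?mfin ?measureU2//; exact: measurableU.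
- move=> G H oG oH GH0; have [mG mH] := (mopen oG, mopen oH).
  apply: (cvgr_le_limit (cvgD (cvgm _ oG) (cvgm _ oH)) (cvgm _ (openU oG oH))).
  by apply: nearW => i; rewrite /GRing.add/= -fineD ?mfin// measureU.
- move=> e e0; have [K Kc Ke] := mtight e e0; exists K => //.
  have oK : open (~` K) by apply: closed_openC; exact: compact_closed.
  apply: limr_le; first by apply: cvgP; exact: cvgm.
  apply: filterS Ke => i.
  by rewrite -lee_fin fineK// mfin//; exact: mopen.
exists nu; split => //; last by rewrite nuT; apply: cvgm; exact: openT.
move=> G oG e e0; near=> i; rewrite (@le_trans _ _ (lam G))//.
  have : (fine (nu G))%:E = nu G.
    by rewrite fineK// fin_num_measure//; exact: mopen.
  by have := nule G oG; move=> /[swap] <-; rewrite lee_fin.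
rewrite -lerBlDr; near: i.
by apply: (cvgr_ge _ (cvgm _ oG)); rewrite gtrBl.
Unshelve. all: by end_near. Qed.

End ultra_limit.

Lemma continuous_borel_measurable (R : realType) (X : ptopologicalType)
    (f : X -> R) : continuous f -> measurable_fun setT (f : borel X -> R).
Proof.
move=> /continuousP cf; apply: (measurability _ (RGenOpens.measurableE R)).
move=> _ [_ [a [b ->] <-]]; rewrite setTI; apply: sub_sigma_algebra.
exact/cf/interval_open.
Qed.

Lemma bounded_measurable_integrable d (T : measurableType d) (R : realType)
    (m : {finite_measure set T -> \bar R}) (f : T -> R) (M : R) :
  measurable_fun setT f -> (forall x, `|f x| <= M) ->
  m.-integrable setT (EFin \o f).
Proof.
move=> mf fM; apply: le_integrable (finite_measure_integrable_cst m M _) => //.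
  exact/measurable_EFinP.
by move=> x _ /=; rewrite lee_fin (le_trans (fM x))// ler_norm.
Qed.

Lemma integrable_cst_indic d (T : measurableType d) (R : realType)
    (m : {finite_measure set T -> \bar R}) (A : set T) (c : R) :
  measurable A -> m.-integrable setT (EFin \o (fun x => c * \1_A x)).
Proof.
move=> mA; apply: (@bounded_measurable_integrable _ _ _ _ _ `|c|).
  exact: measurable_funM.
move=> x; rewrite normrM indicE.
by case: (_ \in _); rewrite ?normr1 ?normr0 ?mulr1 ?mulr0.
Qed.

Lemma Rintegral_cst_indic d (T : measurableType d) (R : realType)
    (m : {finite_measure set T -> \bar R}) (A : set T) (c : R) :
  measurable A -> \int[m]_x (c * \1_A x) = c * fine (m A).
Proof.
move=> mA; rewrite RintegralZl//.
  by rewrite /Rintegral integral_indic// setIT.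
rewrite (_ : \1_A = fun x => 1 * \1_A x); first exact: integrable_cst_indic.
by apply/funext => x; rewrite mul1r.
Qed.

Section weak_convergence.
Context {R : realType} {X : ptopologicalType} {I : Type} (F : set_system I).
Context {FF : ProperFilter F}.
Variable m : I -> {finite_measure set (borel X) -> \bar R}.
Variable nu : {finite_measure set (borel X) -> \bar R}.
Hypothesis nu_le : forall G : set X, open G -> forall e : R, 0 < e ->
  \forall i \near F, fine (nu G) <= fine (m i G) + e.
Implicit Types (f g : borel X -> R).

Let cont_int (mu : {finite_measure set (borel X) -> \bar R}) (g : X -> R) M :
  continuous g -> (forall x, 0 <= g x <= M) ->
  mu.-integrable setT (EFin \o (g : borel X -> R)).
Proof.
move=> cg gM; apply: (@bounded_measurable_integrable _ _ _ _ _ M).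
  exact: continuous_borel_measurable.
by move=> x; have /andP[g0 g1] := gM x; rewrite ger0_norm.
Qed.

Let pos_measurable (g : X -> R) (c : R) : continuous g ->
  open [set x | c < g x] /\ @measurable _ (borel X) [set x | c < g x].
Proof.
move=> cg; have oc : open [set x | c < g x].
  by move/continuousP: cg => /(_ [set t | c < t]); apply; exact: open_gt.
by split => //; exact: sub_sigma_algebra.
Qed.

(* Slicing g at the heights d, 2d, ..., nd replaces integrals by masses of the
   open sets {g > kd}, up to the error d m_i(g > 0). *)
Let slice (d : R) (n : nat) (g : X -> R) : 0 < d -> continuous g ->
  (forall x, 0 <= g x <= d *+ n) -> forall e : R, 0 < e ->
  \forall i \near F, \int[nu]_x (g x : R) <=
    d * fine (m i [set x | 0 < g x]) + \int[m i]_x (g x) + e.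
Proof.
move=> d0; elim: n g => [|n IH] g cg gn e e0.
  apply: nearW => i.
  have g0 x : g x = 0 by apply/eqP; rewrite eq_le andbC; exact: gn.
  rewrite (_ : g = cst 0); last by apply/funext.
  rewrite !Rintegral_cst// !mul0r addr0; apply: addr_ge0; last exact: ltW.
  by apply: mulr_ge0; [exact: ltW|exact: fine_ge0].
(* The lowest slice is peeled off; the induction hypothesis treats the remainder [g2], whose height
   has dropped by [d]. *)
pose g1 x := Num.min (g x) d; pose g2 x := Num.max (g x - d) 0.
have g12 x : g x = g1 x + g2 x.
  by rewrite /g1 /g2; case: (leP (g x) d) => gd;
    rewrite ?maxEle ?minEle; case: ifPn; lra.
have cg1 : continuous g1.
  by move=> x; apply: continuous_min; [exact: cg|exact: cvg_cst].
have cg2 : continuous g2.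
  move=> x; apply: (@continuous_max R X (fun x => g x - d)); last exact: cvg_cst.
  by apply: cvgB; [exact: cg|exact: cvg_cst].
have g1d x : 0 <= g1 x <= d.
  have /andP[g0 _] := gn x.
  by rewrite /g1 le_min g0 (ltW d0)/= ge_min lexx orbT.
have g2n x : 0 <= g2 x <= d *+ n.
  have /andP[g0] := gn x; rewrite mulrSr => gS.
  rewrite /g2 le_max lexx orbT/= ge_max (mulrn_wge0 _ (ltW d0)) andbT.
  by rewrite lerBlDr.
have i1 mu := cont_int mu cg1 g1d.
have i2 mu := cont_int mu cg2 g2n.
have intD (mu : {finite_measure set (borel X) -> \bar R}) :
    \int[mu]_x (g x) = \int[mu]_x (g1 x) + \int[mu]_x (g2 x).
  by rewrite -(RintegralD _ (i1 mu) (i2 mu))//; congr Rintegral;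
    apply/funext.
have e20 : 0 < e / 2 by lra.
have ed0 : 0 < e / 2 / d by rewrite divr_gt0.
have [og mg] := pos_measurable 0 cg.
have [_ mg2] := pos_measurable 0 cg2.
have nu1 : \int[nu]_x (g1 x) <= d * fine (nu [set x | 0 < g x]).
  rewrite -Rintegral_cst_indic//; apply: le_Rintegral (i1 nu) _ _ => //.
    exact: integrable_cst_indic.
  move=> x _; have /andP[_ g1D] := g1d x; rewrite indicE.
  have [gx|gx] := ltP 0 (g x); first by rewrite mem_set// mulr1.
  rewrite memNset/= ?mulr0; last by apply/negP; rewrite -leNgt.
  by rewrite /g1 ge_min gx.
(* Where [g2] is positive, [g1] equals [d]. The error term of the induction hypothesis is thus
   absorbed by the integral of [g1], and only one error [d * m_i(g > 0)] remains however many slices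
   there are. *)
have m1 i : d * fine (m i [set x | 0 < g2 x]) <= \int[m i]_x (g1 x).
  rewrite -Rintegral_cst_indic//; apply: le_Rintegral _ (i1 (m i)) _ => //.
    exact: integrable_cst_indic.
  move=> x _; have /andP[g10 _] := g1d x; rewrite indicE.
  have [g2x|g2x] := ltP 0 (g2 x); last first.
    by rewrite memNset/= ?mulr0//; apply/negP; rewrite -leNgt.
  rewrite mem_set// mulr1 /g1 le_min lexx andbT.
  by move: g2x; rewrite /g2 lt_max ltxx orbF subr_gt0 => /ltW.
near=> i.
rewrite !intD.
have H2 : \int[nu]_x (g2 x) <=
    d * fine (m i [set x | 0 < g2 x]) + \int[m i]_x (g2 x) + e / 2.
  by near: i; exact: IH.
have H1 : fine (nu [set x | 0 < g x]) <=
    fine (m i [set x | 0 < g x]) + e / 2 / d by near: i; exact: nu_le.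
have {}H1 : d * fine (nu [set x | 0 < g x]) <=
    d * fine (m i [set x | 0 < g x]) + e / 2.
  have -> : e / 2 = d * (e / 2 / d) by rewrite [d * _]mulrC divfK// gt_eqF.
  by rewrite -mulrDr ler_pM2l.
have := m1 i.
move: nu1 H1 H2; set a := Rintegral _ _ _; lra.
Unshelve. all: by end_near. Qed.

Hypothesis mass_cvg : fine (m i setT) @[i --> F] --> fine (nu setT).

Let lsc (g : X -> R) : continuous g -> (forall x, 0 <= g x <= 1) ->
  forall e : R, 0 < e ->
  \forall i \near F, \int[nu]_x (g x : R) <= \int[m i]_x (g x) + e.
Proof.
move=> cg g1 e e0.
have nuT0 : 0 <= fine (nu setT) by exact: fine_ge0.
(* Eventually the mass of [m i] is at most that of [nu] plus 1, so the slicing error stays below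
   [e / 2]. *)
pose d := e / 2 / (fine (nu setT) + 1).
have d0 : 0 < d by rewrite divr_gt0 ?divr_gt0// ltr_wpDl.
pose n := Num.bound d^-1.
have gn x : 0 <= g x <= d *+ n.
  have /andP[-> gx1]/= := g1 x; rewrite (le_trans gx1)//.
  rewrite -mulr_natl -ler_pdivrMr// div1r ltW// archi_boundP//.
  by rewrite invr_ge0 ltW.
have e20 : 0 < e / 2 by lra.
near=> i.
have : \int[nu]_x (g x : R) <=
    d * fine (m i [set x | 0 < g x]) + \int[m i]_x (g x) + e / 2.
  by near: i; exact: slice gn _ e20.
have : fine (m i setT) <= fine (nu setT) + 1.
  by near: i; apply: (cvgr_le _ mass_cvg); rewrite ltrDl.
have : fine (m i [set x | 0 < g x]) <= fine (m i setT).
  have [_ mg] := pos_measurable 0 cg.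
  by rewrite fine_le ?fin_num_measure// le_measure ?inE.
move=> /le_trans /[apply]; rewrite -(ler_pM2l d0).
rewrite [X in _ <= X](_ : _ = e / 2); last first.
  by rewrite /d divfK// gt_eqF// ltr_wpDl.
set a := Rintegral _ _ _; set b := Rintegral _ _ _; lra.
Unshelve. all: by end_near. Qed.

(** The one-sided bound [lsc] for [1 - g], combined with convergence of the total masses, is the
    opposite bound for [g]. *)
Lemma weak_cvg_Rintegral (g : X -> R) : continuous g ->
  (forall x, 0 <= g x <= 1) ->
  (\int[m i]_x (g x : R)) @[i --> F] --> \int[nu]_x (g x : R).
Proof.
move=> cg g1; apply/cvgrPdist_le => e e0.
have e20 : 0 < e / 2 by lra.
have cg' : continuous (fun x => 1 - g x).
  by move=> x; apply: cvgB; [exact: cvg_cst|exact: cg].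
have g1' x : 0 <= 1 - g x <= 1 by have := g1 x; lra.
have intB (mu : {finite_measure set (borel X) -> \bar R}) :
    \int[mu]_x (1 - g x) = fine (mu setT) - \int[mu]_x (g x).
  rewrite RintegralB//; last exact: cont_int g1.
    by rewrite Rintegral_cst// mul1r.
  exact: finite_measure_integrable_cst.
near=> i; rewrite ler_norml lerBlDr; apply/andP; split; last first.
  by rewrite addrC; near: i; exact: lsc.
have : \int[nu]_x (1 - g x) <= \int[m i]_x (1 - g x) + e / 2.
  by near: i; exact: lsc.
rewrite !intB.
have : fine (m i setT) <= fine (nu setT) + e / 2.
  by near: i; apply: (cvgr_le _ mass_cvg); rewrite ltrDl.
set a := Rintegral _ _ _; set b := Rintegral _ _ _; lra.
Unshelve. all: by end_near. Qed.

End weak_convergence.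

(** * Uniform convergence on Lipschitz functions *)

Lemma Lip1_continuous (R : realType) (X : ptopologicalType) (p : X -> X -> R)
    (f : X -> R) : pseudometric p -> (forall a, continuous (p a)) ->
  Lip1 p f -> continuous f.
Proof.
move=> [_ pxx _ _] pc fp x; apply/cvgrPdist_le => e e0.
have := cvgr_le _ (pc x x) e; rewrite pxx => /(_ _ e0).
by apply: filterS => y; exact: le_trans.
Qed.

Section bump_approximation.
Context {R : realType} {X : ptopologicalType}.
Variables (p : X -> X -> R) (d : R).
Hypothesis p_pseudometric : pseudometric p.
Hypothesis p_continuous : forall a, continuous (p a).
Hypothesis d0 : 0 < d.
Implicit Types (f : X -> R) (l : seq X).

(** Equal to 1 where [p a x <= d], to 0 where [p a x >= 2 * d], and affine in [p a x] in between. *)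
Definition bump a x := Num.min 1 (Num.max 0 (2 - p a x / d)).

(* Interpolates f at the points of l; the weights of the points form a partition
   of unity where one of the bumps is 1. *)
Fixpoint bump_approx f l x := if l is a :: l'
  then bump a x * f a + (1 - bump a x) * bump_approx f l' x else 0.

Lemma bump_itv a x : 0 <= bump a x <= 1.
Proof. by rewrite /bump le_min ler01 le_max lexx/= ge_min lexx. Qed.

Lemma bump_continuous a : continuous (bump a).
Proof.
move=> x; apply: (@continuous_min R X (cst 1)); first exact: cvg_cst.
apply: (@continuous_max R X (cst 0)); first exact: cvg_cst.
apply: (@cvgB R R _ _ _ (fun=> 2) (fun x => p a x / d)); first exact: cvg_cst.
by apply: cvgMr_tmp; exact: p_continuous.
Qed.

Lemma bump_approx_continuous f l : continuous (bump_approx f l).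
Proof.
elim: l => [|a l IH] x; first exact: cvg_cst.
apply: cvgD; first by apply: cvgMr_tmp; exact: bump_continuous.
apply: cvgM; last exact: IH.
by apply: cvgB; [exact: cvg_cst|exact: bump_continuous].
Qed.

Lemma bump_approx_le f l (M : R) x : (forall y, `|f y| <= M) ->
  `|bump_approx f l x| <= M.
Proof.
move=> fM; elim: l => [|a l IH]/=; first by rewrite normr0 (le_trans _ (fM x)).
have /andP[b0 b1] := bump_itv a x; have b10 : 0 <= 1 - bump a x by lra.
rewrite (le_trans (ler_normD _ _))// !normrM (ger0_norm b0) (ger0_norm b10).
rewrite (@le_trans _ _ (bump a x * M + (1 - bump a x) * M))//; last by lra.
by rewrite lerD// ler_wpM2l.
Qed.

(** The error at [x] is a convex combination of the errors of the head and of the tail. A head with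
    nonzero weight is within [2 * d] of [x]; at the point [a] the weight is 1, so the uncontrolled
    tail behind it disappears. *)
Lemma bump_approx_Lip1 f l x a : Lip1 p f -> a \in l -> p a x < d ->
  `|bump_approx f l x - f x| <= 2 * d.
Proof.
move=> fp; elim: l => [//|b l IH] al ax /=.
have /andP[b0 b1] := bump_itv b x; have b10 : 0 <= 1 - bump b x by lra.
rewrite (_ : _ - _ = bump b x * (f b - f x) +
  (1 - bump b x) * (bump_approx f l x - f x)); last by ring.
have fst : `|bump b x * (f b - f x)| <= bump b x * (2 * d).
  rewrite normrM (ger0_norm b0).
  have [bx|bx] := leP (p b x) (2 * d); first by rewrite ler_wpM2l// (le_trans (fp _ _)).
  suff -> : bump b x = 0 by rewrite !mul0r.
  have : 2 - p b x / d <= 0 by rewrite subr_le0 ler_pdivlMr// ltW.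
  by rewrite /bump => /max_idPl ->; apply/min_idPr.
rewrite (le_trans (ler_normD _ _))//.
move: al; rewrite inE => /predU1P[ab|al].
  have b1' : bump b x = 1.
    apply/min_idPl; rewrite le_max; apply/orP; right.
    rewrite lerBrDr addrC -lerBrDr (@le_trans _ _ 1)//; last lra.
    by rewrite ler_pdivrMr// mul1r -ab ltW.
  by move: fst; rewrite b1' subrr mul0r normr0 addr0 !mul1r.
rewrite (_ : 2 * d = bump b x * (2 * d) + (1 - bump b x) * (2 * d)); last by ring.
by rewrite lerD// normrM (ger0_norm b10) ler_wpM2l// IH.
Qed.

Lemma bump_approx_compact (K : set X) : compact K -> exists l,
  forall f x, Lip1 p f -> K x -> `|bump_approx f l x - f x| <= 2 * d.
Proof.
have [_ pxx _ _] := p_pseudometric.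
rewrite compact_cover => /(_ X setT (fun a => [set x | p a x < d])) [].
- move=> a _; have /continuousP /(_ [set t | t < d]) := @p_continuous a.
  by apply; exact: open_lt.
- by move=> x _; exists x => //=; rewrite pxx.
move=> D _ KD; exists (finmap.enum_fset D) => f x fp /KD[a /= aD ax].
exact: bump_approx_Lip1 aD ax.
Qed.

End bump_approximation.

Section uniform_convergence.
Context {R : realType} {X : ptopologicalType} {I : Type} (F : set_system I).
Context {FF : ProperFilter F}.
Variable m : I -> {finite_measure set (borel X) -> \bar R}.
Variable nu : {finite_measure set (borel X) -> \bar R}.
Variable p : X -> X -> R.
Hypothesis X_hausdorff : hausdorff_space X.
Hypothesis p_pseudometric : pseudometric p.
Hypothesis p_continuous : forall a, continuous (p a).
Hypothesis weak_cvg : forall g : X -> R, continuous g ->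
  (forall x, 0 <= g x <= 1) ->
  (\int[m i]_x (g x : R)) @[i --> F] --> \int[nu]_x (g x : R).

Local Notation fmeas := {finite_measure set (borel X) -> \bar R}.

Let bounded_int (mu : fmeas) (g : X -> R) M :
  continuous g -> (forall x, `|g x| <= M) ->
  mu.-integrable setT (EFin \o (g : borel X -> R)).
Proof.
move=> cg gM; apply: (@bounded_measurable_integrable _ _ _ _ _ M) => //.
exact: continuous_borel_measurable.
Qed.

(** [f] enters only through its finitely many values on [l], all bounded by [M], so the threshold in
    [F] does not depend on [f]. The weight [g] is there for the induction: it collects the factors
    [1 - bump] of the points already treated. *)
Lemma bump_approx_uniform_cvg (d : R) (l : seq X) (M e : R) (g : X -> R) :
  0 <= M -> 0 < e -> continuous g -> (forall x, 0 <= g x <= 1) ->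
  \forall i \near F, forall f : X -> R, (forall x, `|f x| <= M) ->
    `|\int[m i]_x (g x * bump_approx p d f l x) -
      \int[nu]_x (g x * bump_approx p d f l x)| <= e.
Proof.
move=> M0; elim: l e g => [|a l IH] e g e0 cg g1.
  apply: nearW => i f fM /=.
  rewrite (_ : (fun x : borel X => g x * 0) = cst 0); last first.
    by apply/funext => x; rewrite mulr0.
  by rewrite !Rintegral_cst// !mul0r subrr normr0 ltW.
have e20 : 0 < e / 2 by lra.
have M10 : 0 < M + 1 by rewrite ltr_wpDl.
pose g1' x := g x * bump p d a x; pose g2 x := g x * (1 - bump p d a x).
have cg1 : continuous g1'.
  by move=> x; apply: cvgM; [exact: cg|exact: bump_continuous].
have cg2 : continuous g2.
  move=> x; apply: cvgM; first exact: cg.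
  by apply: cvgB; [exact: cvg_cst|exact: bump_continuous].
have b01 x : 0 <= 1 - bump p d a x <= 1.
  by have := bump_itv p d a x; lra.
have g11 x : 0 <= g1' x <= 1.
  have /andP[g0 gl1] := g1 x; have /andP[b0 b1] := bump_itv p d a x.
  by rewrite mulr_ge0//= mulr_ile1.
have g21 x : 0 <= g2 x <= 1.
  have /andP[g0 gl1] := g1 x; have /andP[b0 b1] := b01 x.
  by rewrite mulr_ge0//= mulr_ile1.
near=> i => f fM.
have step (mu : fmeas) : \int[mu]_x (g x * bump_approx p d f (a :: l) x) =
    f a * \int[mu]_x (g1' x) + \int[mu]_x (g2 x * bump_approx p d f l x).
  have int1 : mu.-integrable setT (EFin \o (g1' : borel X -> R)).
    by apply: (@bounded_int _ _ 1) => // x; have := g11 x; rewrite ler_norml; lra.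
  rewrite -RintegralZl// -RintegralD//.
  - by congr Rintegral; apply/funext => x /=; rewrite /g1' /g2; ring.
  - rewrite (_ : EFin \o _ = (fun x => (f a)%:E * (EFin \o g1') x)%E).
      exact: integrableZl.
    by apply/funext => x /=; rewrite EFinM.
  - apply: (@bounded_int _ _ M) => [x|x].
      by apply: cvgM; [exact: cg2|exact: bump_approx_continuous].
    have /andP[g20 g2l1] := g21 x.
    rewrite normrM (ger0_norm g20) -[leRHS]mul1r ler_pM//.
    exact: bump_approx_le.
rewrite !step.
have H1 : `|\int[nu]_x (g1' x) - \int[m i]_x (g1' x)| <= e / 2 / (M + 1).
  near: i; have /cvgrPdist_le := weak_cvg cg1 g11; apply.
  by rewrite divr_gt0.
have H2 : `|\int[m i]_x (g2 x * bump_approx p d f l x) -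
      \int[nu]_x (g2 x * bump_approx p d f l x)| <= e / 2.
  by move: (f) fM; near: i; exact: IH.
rewrite opprD addrACA -mulrBr (le_trans (ler_normD _ _))//.
rewrite (splitr e) lerD// normrM distrC.
rewrite (@le_trans _ _ ((M + 1) * (e / 2 / (M + 1))))//.
  by rewrite ler_pM// (le_trans (fM a))// lerDl.
by rewrite mulrC divfK// gt_eqF.
Unshelve. all: by end_near. Qed.

Variable C : R.
Hypothesis m_bounded : \forall i \near F, fine (m i setT) <= C.
Hypothesis nu_bounded : fine (nu setT) <= C.
Hypothesis tight : forall e : R, 0 < e -> exists K : set X, [/\ compact K,
  \forall i \near F, fine (m i (~` K)) <= e & fine (nu (~` K)) <= e].

(** On [K] the integrand is at most [e1] and the mass at most [C]; off [K] it is at most [2 * M] and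
    the mass at most [e2]. *)
Let approx_error (mu : fmeas) (K : set X) (f g : X -> R) (M e1 e2 : R) :
  0 <= M -> 0 <= e1 ->
  compact K -> continuous f -> continuous g ->
  (forall x, `|f x| <= M) -> (forall x, `|g x| <= M) ->
  (forall x, K x -> `|g x - f x| <= e1) ->
  fine (mu setT) <= C -> fine (mu (~` K)) <= e2 ->
  `|\int[mu]_x (g x) - \int[mu]_x (f x)| <= e1 * C + 2 * M * e2.
Proof.
move=> M0 e10 Kc cf cg fM gM gf muC muK.
have mK : @measurable _ (borel X) (~` K).
  by apply: sub_sigma_algebra; apply: closed_openC; exact: compact_closed.
have intf := bounded_int mu cf fM; have intg := bounded_int mu cg gM.
have gfM x : `|g x - f x| <= 2 * M.
  by rewrite (le_trans (ler_normB _ _))// mulr_natl mulr2n lerD.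
have cgf : continuous (fun x => g x - f x).
  by move=> x; apply: cvgB; [exact: cg|exact: cf].
have intgf := bounded_int mu cgf gfM.
rewrite -RintegralB// (le_trans (le_normr_Rintegral _ _))//.
have intc : mu.-integrable setT (EFin \o (cst e1 : borel X -> R)).
  exact: finite_measure_integrable_cst.
have inti := @integrable_cst_indic _ _ _ mu (~` K) (2 * M) mK.
apply: (@le_trans _ _ (\int[mu]_x (e1 + 2 * M * \1_(~` K) x))).
  apply: le_Rintegral => //.
  - exact: integrable_norm intgf.
  - rewrite (_ : EFin \o _ = (EFin \o cst e1) \+
      (EFin \o (fun x => 2 * M * \1_(~` K) x)%R))%E; first exact: integrableD.
    by apply/funext => x /=; rewrite EFinD.
  - move=> x _; rewrite indicE; have [Kx|Kx] := pselect (K x).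
      by rewrite memNset//= mulr0 addr0 gf.
    by rewrite mem_set//= mulr1 (le_trans (gfM x))// lerDr.
rewrite RintegralD// Rintegral_cst// Rintegral_cst_indic//.
by rewrite lerD// ler_wpM2l// mulr_ge0.
Qed.

Lemma bounded_Lip1_uniform_cvg (M e : R) : 0 <= M -> 0 < e ->
  \forall i \near F, forall f : X -> R, Lip1 p f -> (forall x, `|f x| <= M) ->
    `|\int[m i]_x (f x : R) - \int[nu]_x (f x : R)| <= e.
Proof.
move=> M0 e0.
have C0 : 0 <= C by rewrite (le_trans _ nu_bounded)// fine_ge0.
(* [d] and [e2] make each of [2 * d * C] and [2 * M * e2] at most [e / 8]; the added 1 guards
   against [C] or [M] being 0. *)
pose d := e / 8 / (2 * (C + 1)).
have d0 : 0 < d by rewrite divr_gt0 ?mulr_gt0 ?ltr_wpDl//; lra.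
pose e2 := e / 8 / (2 * (M + 1)).
have e20 : 0 < e2 by rewrite divr_gt0 ?mulr_gt0 ?ltr_wpDl//; lra.
have [K [Kc mK nuK]] := tight e20.
have [l Kl] := bump_approx_compact p_pseudometric p_continuous d0 Kc.
have small : 2 * d * C + 2 * M * e2 <= e / 4.
  have -> : e / 4 = 2 * d * (C + 1) + 2 * e2 * (M + 1).
    rewrite /d /e2; field; apply/andP; split; apply: lt0r_neq0;
      by rewrite ltr_wpDl.
  by rewrite lerD//; nra.
have e40 : 0 < e / 4 by lra.
have c1 : continuous (cst 1 : X -> R) by move=> x; exact: cvg_cst.
have o1 x : 0 <= (cst 1 : X -> R) x <= 1 by rewrite /= ler01 lexx.
near=> i => f fp fM.
have cf := Lip1_continuous p_pseudometric p_continuous fp.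
set g := bump_approx p d f l.
have cg : continuous g by exact: bump_approx_continuous.
have gM x : `|g x| <= M by exact: bump_approx_le.
have gf x : K x -> `|g x - f x| <= 2 * d by exact: Kl.
have H1 : `|\int[m i]_x (g x) - \int[m i]_x (f x)| <= e / 4.
  apply: le_trans small; apply: (approx_error M0 _ Kc) => //; first lra.
    by near: i.
  by near: i.
have H2 : `|\int[nu]_x (g x) - \int[nu]_x (f x)| <= e / 4.
  by apply: le_trans small; apply: (approx_error M0 _ Kc) => //; lra.
have H3 : `|\int[m i]_x (g x) - \int[nu]_x (g x)| <= e / 4.
  have : forall f : X -> R, (forall x, `|f x| <= M) ->
    `|\int[m i]_x (1 * bump_approx p d f l x) -
      \int[nu]_x (1 * bump_approx p d f l x)| <= e / 4.
    by near: i; exact: (bump_approx_uniform_cvg d l M0 e40 c1 o1).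
  move=> /(_ f fM).
  under eq_Rintegral do rewrite mul1r.
  by under [X in _ - X]eq_Rintegral do rewrite mul1r.
move: H1 H2 H3; rewrite !ler_norml.
set a := Rintegral _ _ _; set b := Rintegral _ _ _; set a' := Rintegral _ _ _.
set b' := Rintegral _ _ _; lra.
Unshelve. all: by end_near. Qed.

Variable h : X -> R.
Hypothesis h_continuous : continuous h.
Hypothesis h_ge0 : forall x, 0 <= h x.
Hypothesis h_int : \forall i \near F,
  (m i).-integrable setT (EFin \o (h : borel X -> R)).
Hypothesis h_nu_int : nu.-integrable setT (EFin \o (h : borel X -> R)).
Hypothesis h_unif : forall e : R, 0 < e -> exists T : R, [/\ 0 <= T,
  \forall i \near F, \int[m i]_x (Num.max (h x - T) 0 : R) <= e &
  \int[nu]_x (Num.max (h x - T) 0 : R) <= e].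

Let truncation_error (mu : fmeas) (f : X -> R) (T : R) :
  0 <= T -> continuous f -> (forall x, `|f x| <= h x) ->
  mu.-integrable setT (EFin \o (h : borel X -> R)) ->
  `|\int[mu]_x (f x) - \int[mu]_x (Num.max (- T) (Num.min T (f x)))| <=
  \int[mu]_x (Num.max (h x - T) 0).
Proof.
move=> T0 cf fh inth.
have intf : mu.-integrable setT (EFin \o (f : borel X -> R)).
  apply: le_integrable inth => //.
    by apply/measurable_EFinP; exact: continuous_borel_measurable.
  by move=> x _ /=; rewrite lee_fin (le_trans (fh x))// ler_norm.
have ctr : continuous (fun x => Num.max (- T) (Num.min T (f x))).
  move=> x; apply: (@continuous_max R X (cst (- T))); first exact: cvg_cst.
  by apply: (@continuous_min R X (cst T)); [exact: cvg_cst|exact: cf].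
have inttr : mu.-integrable setT
    (EFin \o ((fun x => Num.max (- T) (Num.min T (f x))) : borel X -> R)).
  apply: (bounded_int mu ctr (M := T)) => x.
  by rewrite ler_norml le_max lexx/= ge_max ge_min lexx; lra.
have chT : continuous (fun x => Num.max (h x - T) 0).
  move=> x; apply: (@continuous_max R X (fun x => h x - T) (cst 0)).
    by apply: cvgB; [exact: h_continuous|exact: cvg_cst].
  exact: cvg_cst.
rewrite -RintegralB// (le_trans (le_normr_Rintegral _ _))//.
  rewrite (_ : EFin \o _ = (EFin \o f) \-
    (EFin \o (fun x => Num.max (- T) (Num.min T (f x)))%R))%E.
    exact: integrableB.
  by apply/funext => x /=; rewrite EFinB.
apply: le_Rintegral => //.
- apply: integrable_norm => //.
  rewrite (_ : EFin \o _ = (EFin \o f) \-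
    (EFin \o (fun x => Num.max (- T) (Num.min T (f x)))%R))%E.
    exact: integrableB.
  by apply/funext => x /=; rewrite EFinB.
- apply: le_integrable inth => //.
    by apply/measurable_EFinP; exact: continuous_borel_measurable.
  move=> x _ /=; rewrite lee_fin !ger0_norm ?le_max ?lexx ?orbT// ge_max h_ge0.
  by rewrite gerBl T0.
- move=> x _; have := fh x; rewrite ler_norml => /andP[f1 f2].
  have := h_ge0 x; rewrite ler_norml minEle maxEle maxEle.
  by case: (leP T (f x)) => Tf; do ?case: ifPn; rewrite -?ltNge => *; lra.
Qed.

Lemma Lip1_uniform_cvg (e : R) : 0 < e ->
  \forall i \near F, forall f : X -> R, Lip1 p f -> (forall x, `|f x| <= h x) ->
    `|\int[m i]_x (f x : R) - \int[nu]_x (f x : R)| <= e.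
Proof.
move=> e0; have e30 : 0 < e / 3 by lra.
have [T [T0 mT nuT]] := h_unif e30.
near=> i => f fp fh.
have cf := Lip1_continuous p_pseudometric p_continuous fp.
have H1 := truncation_error T0 cf fh h_nu_int.
have H2 : `|\int[m i]_x (f x) - \int[m i]_x (Num.max (- T) (Num.min T (f x)))| <=
    \int[m i]_x (Num.max (h x - T) 0).
  by apply: truncation_error => //; near: i.
have H3 : \int[m i]_x (Num.max (h x - T) 0) <= e / 3 by near: i.
(* Clipping at height [T] is nonexpansive, so [f'] remains in [Lip1 p] and the bounded case applies
   to it. *)
pose f' x := Num.max (- T) (Num.min T (f x)).
have H4 : `|\int[m i]_x (f' x) - \int[nu]_x (f' x)| <= e / 3.
  have : Lip1 p f'.
    move=> x y; have := fp x y; rewrite !ler_norml /f' !minEle !maxEle.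
    by do ?case: ifPn; rewrite -?ltNge => *; lra.
  have : forall x, `|f' x| <= T.
    by move=> x; rewrite ler_norml le_max lexx/= ge_max ge_min lexx; lra.
  by move: (f') => f1 /[swap]; move: f1; near: i; exact: bounded_Lip1_uniform_cvg.
move: H1 H2 H3 H4 nuT; rewrite !ler_norml -/f'.
set a := Rintegral _ _ _; set b := Rintegral _ _ _; set a' := Rintegral _ _ _.
set b' := Rintegral _ _ _; lra.
Unshelve. all: by end_near. Qed.

End uniform_convergence.

(** * Signed measures *)

Section charge_difference.
Context {R : realType} {d} {T : measurableType d}.
Implicit Types (xi mu nu la : {charge set T -> \bar R}) (f : T -> R).
Local Notation fmeas := {finite_measure set T -> \bar R}.
Local Open Scope ereal_scope.

Lemma dominated_integrable (a b : {measure set T -> \bar R}) f :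
  (forall A, measurable A -> a A <= b A) ->
  b.-integrable setT (EFin \o f) -> a.-integrable setT (EFin \o f).
Proof.
move=> ab /integrableP[mf bf]; apply/integrableP; split => //.
apply: le_lt_trans bf; apply: ge0_le_measure_integral => //.
exact: measurableT_comp.
Qed.

(** Minimality of the Jordan decomposition: the positive part of [A] is [xi] on the intersection of
    [A] with the positive Hahn set, where subtracting [b] only decreases [a]; the negative part is
    symmetric. *)
Lemma jordan_le_difference xi (a b : {measure set T -> \bar R}) :
  fin_num_fun b ->
  (forall A, measurable A -> xi A = a A - b A) ->
  (forall A, measurable A -> jordan_pos (hahn_pairP xi) A <= a A) /\
  (forall A, measurable A -> jordan_neg (hahn_pairP xi) A <= b A).
Proof.
move=> bfin xiE; have [[mP _] [mN _] _ _] := hahn_pairP xi; split => A mA.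
- rewrite jordan_posE cjordan_posE /crestr0 mem_set// /crestr.
  have mAP : measurable (A `&` (hahn_pair xi).1) by exact: measurableI.
  rewrite xiE// (@le_trans _ _ (a (A `&` (hahn_pair xi).1)))//.
    by rewrite geeDl// oppe_le0.
  by rewrite le_measure ?inE//; exact: subIsetl.
- rewrite jordan_negE cjordan_negE /crestr0 mem_set// /crestr.
  have mAN : measurable (A `&` (hahn_pair xi).2) by exact: measurableI.
  rewrite xiE// fin_num_oppeB ?bfin//.
  rewrite (@le_trans _ _ (b (A `&` (hahn_pair xi).2)))//.
    by rewrite addeC geeDl// oppe_le0.
  by rewrite le_measure ?inE//; exact: subIsetl.
Qed.

(** With Jordan parts [P] and [N], the identity [P - N = a - b] is rewritten as the equality
    [P + b = a + N] of positive measures, for which integration is additive; finiteness of all four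
    integrals permits rearranging back. *)
Lemma charge_integral_difference xi (a b : {measure set T -> \bar R}) f :
  fin_num_fun a -> fin_num_fun b ->
  (forall A, measurable A -> xi A = a A - b A) ->
  a.-integrable setT (EFin \o f) -> b.-integrable setT (EFin \o f) ->
  charge_integral xi f = (\int[a]_x f x - \int[b]_x f x)%:E.
Proof.
move=> afin bfin xiE ia ib; have [leP leN] := jordan_le_difference bfin xiE.
rewrite /charge_integral.
set P := jordan_pos _; set N := jordan_neg _.
have iP : P.-integrable setT (EFin \o f) by exact: dominated_integrable ia.
have iN : N.-integrable setT (EFin \o f) by exact: dominated_integrable ib.
have mf : measurable_fun setT (EFin \o f) by exact: measurable_int ia.
have PbaN : \int[measure_add P b]_x (f x)%:E = \int[measure_add a N]_x (f x)%:E.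
  apply: eq_measure_integral => A mA _.
  apply: etrans (measure_addE P b A) (etrans _ (esym (measure_addE a N A))).
  have abPN : a A - b A = P A - N A.
    by rewrite -xiE// (jordan_decomp (hahn_pairP xi) mA) /cadd/= cscaleN1.
  have fP : P A \is a fin_num by exact: fin_num_measure.
  have fN : N A \is a fin_num by exact: fin_num_measure.
  have fa : a A \is a fin_num by exact: afin.
  have fb : b A \is a fin_num by exact: bfin.
  have key (u v w z : \bar R) : u \is a fin_num -> v \is a fin_num ->
      w \is a fin_num -> z \is a fin_num -> u - v = w - z -> w + v = u + z.
    move=> /fineK<- /fineK<- /fineK<- /fineK<-.
    by rewrite -!EFinB -!EFinD => -[] uvwz; congr EFin; lra.
  exact: key fa fb fP fN abPN.
rewrite !integral_measure_add// in PbaN.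
move: PbaN; rewrite /Rintegral.
have := integrable_fin_num measurableT iP; have := integrable_fin_num measurableT iN.
have := integrable_fin_num measurableT ia; have := integrable_fin_num measurableT ib.
move=> /fineK<- /fineK<- /fineK<- /fineK<- /=.
by rewrite -!EFinB -!EFinD => -[] PbaN; congr EFin; lra.
Qed.

Definition charge_integrable mu f :=
  (variation_measure mu).-integrable setT (EFin \o f).

Lemma charge_integrableP mu f : charge_integrable mu f <->
  (jordan_pos (hahn_pairP mu)).-integrable setT (EFin \o f) /\
  (jordan_neg (hahn_pairP mu)).-integrable setT (EFin \o f).
Proof.
split=> [imu|[iP iN]].
  split; apply: dominated_integrable imu => A mA.
    by rewrite /variation_measure/= /charge_variation leeDl.
  by rewrite /variation_measure/= /charge_variation leeDr.
have mf : measurable_fun setT (EFin \o f) by exact: measurable_int iP.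
apply/integrableP; split => //.
rewrite (@eq_measure_integral _ _ _ _ (measure_add (jordan_pos (hahn_pairP mu))
  (jordan_neg (hahn_pairP mu)))); last first.
  by move=> A mA _; apply/esym; exact: measure_addE.
rewrite ge0_integral_measure_add//; last exact: measurableT_comp.
by move/integrableP : iP => [_ ?]; move/integrableP : iN => [_ ?];
  exact: lte_add_pinfty.
Qed.

(** The Jordan parts of a difference are not the differences of Jordan parts; the previous lemma is
    applied to the representation [(mP + nN) - (nP + mN)] instead. *)
Lemma charge_integral_csub mu nu f :
  charge_integrable mu f -> charge_integrable nu f ->
  charge_integral (csub mu nu) f =
    (\int[jordan_pos (hahn_pairP mu)]_x f x
     - \int[jordan_pos (hahn_pairP nu)]_x f x
     - (\int[jordan_neg (hahn_pairP mu)]_x f x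
     - \int[jordan_neg (hahn_pairP nu)]_x f x))%:E.
Proof.
move=> /charge_integrableP[imP imN] /charge_integrableP[inP inN].
set mP := jordan_pos _ in imP *; set nP := jordan_pos _ in inP *.
set mN := jordan_neg _ in imN *; set nN := jordan_neg _ in inN *.
have finD (a b : fmeas) : fin_num_fun (measure_add a b).
  by move=> A mA; rewrite measure_addE fin_numD !fin_num_measure.
have mf : measurable_fun setT (EFin \o f) by exact: measurable_int imP.
have iD (a b : fmeas) : a.-integrable setT (EFin \o f) ->
    b.-integrable setT (EFin \o f) ->
    (measure_add a b).-integrable setT (EFin \o f).
  move=> /integrableP[_ fa] /integrableP[_ fb]; apply/integrableP; split => //.
  rewrite ge0_integral_measure_add//; last exact: measurableT_comp.
  exact: lte_add_pinfty.
have iDE (a b : fmeas) : a.-integrable setT (EFin \o f) ->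
    b.-integrable setT (EFin \o f) ->
    (\int[measure_add a b]_x f x = \int[a]_x f x + \int[b]_x f x)%R.
  move=> ia ib; rewrite /Rintegral integral_measure_add// fineD//;
    exact: integrable_fin_num.
rewrite (@charge_integral_difference _ (measure_add mP nN) (measure_add nP mN)).
- by rewrite !iDE//; congr EFin; ring.
- exact: finD.
- exact: finD.
- move=> A mA.
  suff : csub mu nu A = (mP A + nN A) - (nP A + mN A).
    by move=> ->; congr (_ - _); apply/esym; exact: measure_addE.
  have -> : csub mu nu A = mP A - mN A - (nP A - nN A).
    rewrite /csub/= /cadd/= /copp/= (jordan_decomp (hahn_pairP mu) mA).
    by rewrite (jordan_decomp (hahn_pairP nu) mA) /cadd/= !cscaleN1.
  have fmP : mP A \is a fin_num by exact: fin_num_measure.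
  have fmN : mN A \is a fin_num by exact: fin_num_measure.
  have fnP : nP A \is a fin_num by exact: fin_num_measure.
  have fnN : nN A \is a fin_num by exact: fin_num_measure.
  have key (u v w z : \bar R) : u \is a fin_num -> v \is a fin_num ->
      w \is a fin_num -> z \is a fin_num -> u - v - (w - z) = u + z - (w + v).
    move=> /fineK<- /fineK<- /fineK<- /fineK<-.
    by rewrite -!(EFinB, EFinD); congr EFin; ring.
  exact: key fmP fmN fnP fnN.
- exact: iD.
- exact: iD.
Qed.
End charge_difference.

(** Fatou for weak limits: the bound passes to the limit for the truncations
    [Num.min (h x) n.+1%:R], which scale into [0, 1], and then to [h] by monotone convergence. *)
Lemma weak_limit_integral_le (R : realType) (X : ptopologicalType) (I : Type)
    (F : set_system I) {FF : ProperFilter F}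
    (m : I -> {finite_measure set (borel X) -> \bar R})
    (nu : {finite_measure set (borel X) -> \bar R}) (h : X -> R) (e : R) :
  (forall g : X -> R, continuous g -> (forall x, 0 <= g x <= 1) ->
    (\int[m i]_x (g x : R)) @[i --> F] --> \int[nu]_x (g x : R)) ->
  continuous h -> (forall x, 0 <= h x) ->
  (\forall i \near F, (m i).-integrable setT (EFin \o (h : borel X -> R)) /\
    \int[m i]_x (h x) <= e) ->
  nu.-integrable setT (EFin \o (h : borel X -> R)) /\ \int[nu]_x (h x) <= e.
Proof.
move=> weak_cvg ch h0 mh.
have mh' : measurable_fun setT (h : borel X -> R).
  exact: continuous_borel_measurable.
pose g n (x : X) : R := Num.min (h x) n.+1%:R.
have g0 n x : 0 <= g n x by rewrite /g le_min h0 ler0n.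
have cg n : continuous (g n).
  by move=> x; apply: (@continuous_min R X h (cst n.+1%:R)); [exact: ch|exact: cvg_cst].
have mg n : measurable_fun setT (g n : borel X -> R) by exact: continuous_borel_measurable.
have n0 n : 0 < n.+1%:R :> R by rewrite ltr0n.
have ig (mu : {finite_measure set (borel X) -> \bar R}) n :
    mu.-integrable setT (EFin \o (g n : borel X -> R)).
  apply: (@bounded_measurable_integrable _ _ _ _ _ n.+1%:R) => // x.
  by rewrite ger0_norm// /g ge_min lexx orbT.
have gnu n : \int[nu]_x (g n x) <= e.
  have cg' : continuous (fun x => g n x / n.+1%:R).
    by move=> x; apply: cvgMr_tmp; exact: cg.
  have g1 x : 0 <= g n x / n.+1%:R <= 1.
    by rewrite divr_ge0//= ler_pdivrMr// mul1r /g ge_min lexx orbT.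
  have gE (mu : {finite_measure set (borel X) -> \bar R}) :
      \int[mu]_x (g n x / n.+1%:R) = \int[mu]_x (g n x) / n.+1%:R.
    exact: (RintegralZr _ measurableT (ig mu n)).
  have ni0 : 0 < n.+1%:R^-1 :> R by rewrite invr_gt0.
  rewrite -(ler_pM2r ni0) -gE.
  apply: (cvgr_le_limit (weak_cvg _ cg' g1) (cvg_cst (e / n.+1%:R))).
  apply: filterS mh => i [ih ihe]; rewrite gE ler_pM2r//.
  apply: le_trans ihe; apply: (le_Rintegral measurableT (ig _ n) ih) => x _.
  by rewrite /g ge_min lexx.
have gnuE n : (\int[nu]_x (g n x)%:E <= e%:E)%E.
  by have := gnu n; rewrite -lee_fin /Rintegral fineK//; exact: integrable_fin_num (ig _ n).
have hE : (\int[nu]_x (h x)%:E <= e%:E)%E.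
  have gh (x : borel X) : limn (fun n => (g n x)%:E) = (h x)%:E.
    apply: cvg_lim => //; apply: cvg_near_cst; near=> n.
    rewrite /g min_l// ltW//.
    have := archi_boundP (h0 x) => /lt_le_trans; apply.
    rewrite ler_nat; apply: leqW; near: n; exact: nbhs_infty_ge.
  have mg' n : measurable_fun setT (fun x : borel X => (g n x)%:E).
    exact/measurable_EFinP.
  have g0' n (x : borel X) : setT x -> (0 <= (g n x)%:E)%E by rewrite lee_fin.
  have gnd (x : borel X) : setT x -> nondecreasing_seq (fun n => (g n x)%:E).
    move=> _ n k nk; rewrite lee_fin /g le_min !ge_min lexx/= ler_nat.
    by rewrite ltnS nk orbT.
  have := @cvg_monotone_convergence _ _ _ nu setT measurableT _ mg' g0' gnd.
  under [X in _ --> X]eq_integral do rewrite gh.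
  move=> gcvg; rewrite -(cvg_lim _ gcvg)//.
  by apply: lime_le; [exact: cvgP gcvg|exact: nearW].
have ih : nu.-integrable setT (EFin \o (h : borel X -> R)).
  apply/integrableP; split; first exact/measurable_EFinP.
  apply: le_lt_trans (ltry e); apply: le_trans hE.
  by under eq_integral do rewrite /= ger0_norm//.
split => //; rewrite -lee_fin /Rintegral fineK//; exact: integrable_fin_num.
Unshelve. all: by end_near. Qed.

(** * Existence of signed limits of tight families *)

Section tight_weak_limit.
Context {R : realType} {X : ptopologicalType} {I : Type}.
Local Notation fmeas := {finite_measure set (borel X) -> \bar R}.

Definition tight_weak_limit (F : set_system I) (m : I -> fmeas) (nu : fmeas) :=
  [/\ forall g : X -> R, continuous g -> (forall x, 0 <= g x <= 1) ->
        (\int[m i]_x (g x : R)) @[i --> F] --> \int[nu]_x (g x : R),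
      exists2 C : R, \forall i \near F, fine (m i setT) <= C &
        fine (nu setT) <= C &
      forall e : R, 0 < e -> exists K : set X, [/\ compact K,
        \forall i \near F, fine (m i (~` K)) <= e & fine (nu (~` K)) <= e]].

Lemma compact_borel (K : set X) : hausdorff_space X -> compact K ->
  @measurable _ (borel X) K.
Proof.
move=> hX Kc; rewrite -[K]setCK; apply: measurableC; apply: sub_sigma_algebra.
by apply: closed_openC; exact: compact_closed.
Qed.

Lemma ultra_tight_weak_limit (F : set_system I) (m : I -> fmeas) (C : R) :
  UltraFilter F -> hausdorff_space X ->
  (\forall i \near F, (m i setT <= C%:E)%E) ->
  (forall e : R, 0 < e -> exists2 K : set X, compact K &
    \forall i \near F, (m i (~` K) <= e%:E)%E) ->
  exists2 nu : fmeas, radon nu & tight_weak_limit F m nu.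
Proof.
move=> FU hX mC mtight.
have [nu [rnu nu_le nuT]] := ultra_limit_radon_measure hX mC mtight.
have mK (K : set X) : compact K -> @measurable _ (borel X) (~` K).
  by move=> Kc; apply: measurableC; exact: compact_borel.
exists nu => //; split.
- by move=> g cg g1; exact: weak_cvg_Rintegral.
- exists (Num.max C (fine (nu setT))); last by rewrite le_max lexx orbT.
  apply: filterS mC => i; rewrite le_max -lee_fin fineK ?fin_num_measure//.
  by move=> ->.
- move=> e e0; have [K Kc Ke] := mtight e e0.
  have [L [Lc _ Le]] := rnu setT measurableT e e0.
  have KL : ~` (K `|` L) = ~` K `&` ~` L by rewrite setCU.
  (* [K] serves the measures [m i], [L] the Radon limit [nu]. *)
  exists (K `|` L); split; first exact: compactU.
    apply: filterS Ke => i Ke; rewrite -lee_fin fineK ?fin_num_measure//;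
      last by apply: mK; exact: compactU.
    apply: le_trans Ke; rewrite le_measure ?inE//; try exact: mK.
      by apply: mK; exact: compactU.
    by rewrite KL; exact: subIsetl.
  rewrite -lee_fin fineK ?fin_num_measure//; last by apply: mK; exact: compactU.
  apply: le_trans (ltW Le); rewrite setTD le_measure ?inE//; try exact: mK.
    by apply: mK; exact: compactU.
  by rewrite KL; exact: subIsetr.
Qed.

Lemma radon_difference (xi : {charge set (borel X) -> \bar R}) (a b : fmeas) :
  hausdorff_space X -> radon a -> radon b ->
  (forall A, measurable A -> xi A = (a A - b A)%E) ->
  radon (variation_measure xi).
Proof.
move=> hX ra rb xiE B mB e e0; have e20 : 0 < e / 2 by rewrite divr_gt0.
have [K [Kc KB Ke]] := ra B mB _ e20.
have [L [Lc LB Le]] := rb B mB _ e20.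
have mK := compact_borel hX Kc; have mL := compact_borel hX Lc.
exists (K `|` L); split; [exact: compactU|by move=> x [/KB|/LB]|].
have mBKL : @measurable _ (borel X) (B `\` (K `|` L)).
  by apply: measurableD => //; exact: measurableU.
have [aP bN] := jordan_le_difference (fin_num_measure b) xiE.
rewrite (splitr e) EFinD /variation_measure/= /charge_variation.
apply: lteD.
  apply: (le_lt_trans (aP _ mBKL)); apply: le_lt_trans Ke.
  rewrite le_measure ?inE//; first exact: measurableD.
  by apply: setDS; exact: subsetUl.
apply: (le_lt_trans (bN _ mBKL)); apply: le_lt_trans Le.
rewrite le_measure ?inE//; first exact: measurableD.
by apply: setDS; exact: subsetUr.
Qed.

(** The family [c] is indexed so that one statement serves both topologies: [c] is the identity on
    all Radon measures in one case, the inclusion of [radon_Pi Pi] in the other. *)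
Lemma ultra_signed_limit (F : set_system I) (c : I -> radon_measure R X)
    (S : set (radon_measure R X)) : UltraFilter F -> hausdorff_space X ->
  bounded_in_variation S -> uniformly_tight S -> F (c @^-1` S) ->
  exists (nu : radon_measure R X) (a b : fmeas),
    [/\ forall A, measurable A -> nu A = (a A - b A)%E,
        tight_weak_limit F (fun i => jordan_pos (hahn_pairP (c i))) a &
        tight_weak_limit F (fun i => jordan_neg (hahn_pairP (c i))) b].
Proof.
move=> FU hX Sb St FS.
have [C SC] : exists C : R, forall mu, S mu ->
    (variation_measure mu setT <= C%:E)%E.
  move: Sb; rewrite /bounded_in_variation.
  set s := ereal_sup _ => s_lty.
  exists (fine s) => mu Smu.
  have vs : (variation_measure mu setT <= s)%E by apply: ereal_sup_ubound; exists mu.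
  rewrite fineK// fin_real// s_lty andbT (lt_le_trans _ vs)//.
  by rewrite (lt_le_trans _ (measure_ge0 _ _))// ltNy0.
have St' e : 0 < e -> exists2 K : set X, compact K &
    \forall i \near F, (variation_measure (c i) (~` K) <= e%:E)%E.
  move=> e0; have [K Kc Ke] := St e e0; exists K => //.
  by apply: filterS FS => i /Ke /ltW.
have [a ra la] : exists2 a : fmeas, radon a &
    tight_weak_limit F (fun i => jordan_pos (hahn_pairP (c i))) a.
  apply: (@ultra_tight_weak_limit _ _ C) => //.
    by apply: filterS FS => i /SC; apply: le_trans; exact: leeDl.
  move=> e /St'[K Kc Ke]; exists K => //; apply: filterS Ke => i.
  by apply: le_trans; exact: leeDl.
have [b rb lb] : exists2 b : fmeas, radon b &
    tight_weak_limit F (fun i => jordan_neg (hahn_pairP (c i))) b.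
  apply: (@ultra_tight_weak_limit _ _ C) => //.
    by apply: filterS FS => i /SC; apply: le_trans; exact: leeDr.
  move=> e /St'[K Kc Ke]; exists K => //; apply: filterS Ke => i.
  by apply: le_trans; exact: leeDr.
pose xi := cadd (charge_of_finite_measure a) (copp (charge_of_finite_measure b)).
have xiE A : @measurable _ (borel X) A -> xi A = (a A - b A)%E by [].
by exists (RadonMeasure (radon_difference hX ra rb xiE)), a, b.
Qed.

End tight_weak_limit.

(** * Uniform convergence of integrals against signed measures *)

Section charge_convergence.
Context {R : realType} {X : ptopologicalType}.
Local Notation fmeas := {finite_measure set (borel X) -> \bar R}.
Implicit Types (mu nu : {charge set (borel X) -> \bar R}) (f h : X -> R).

Lemma charge_integrable_le mu f h : continuous f ->
  (forall x, `|f x| <= h x) -> charge_integrable mu h ->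
  charge_integrable mu f.
Proof.
move=> cf fh ih; apply: le_integrable ih => //.
  by apply/measurable_EFinP; exact: continuous_borel_measurable.
by move=> x _ /=; rewrite lee_fin (le_trans (fh x))// ler_norm.
Qed.

Lemma charge_integral_jordan mu f : charge_integrable mu f ->
  charge_integral mu f = (\int[jordan_pos (hahn_pairP mu)]_x (f x : R) -
    \int[jordan_neg (hahn_pairP mu)]_x (f x : R))%:E.
Proof.
move=> /charge_integrableP[iP iN].
apply: (charge_integral_difference (fin_num_measure _) (fin_num_measure _) _ iP iN).
by move=> A mA; rewrite (jordan_decomp (hahn_pairP mu) mA) /cadd/= cscaleN1.
Qed.

Section signed_uniform_convergence.
Context {I : Type} (F : set_system I) {FF : ProperFilter F}.
Variables (c : I -> radon_measure R X) (nu : radon_measure R X) (a b : fmeas).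
Hypothesis X_hausdorff : hausdorff_space X.
Hypothesis nuE : forall A, measurable A -> nu A = (a A - b A)%E.
Hypothesis cvg_pos : tight_weak_limit F (fun i => jordan_pos (hahn_pairP (c i))) a.
Hypothesis cvg_neg : tight_weak_limit F (fun i => jordan_neg (hahn_pairP (c i))) b.

Variable h : X -> R.
Hypothesis h_continuous : continuous h.
Hypothesis h_ge0 : forall x, 0 <= h x.
Hypothesis h_int : \forall i \near F, charge_integrable (c i) h.
Hypothesis h_unif : forall e : R, 0 < e -> exists2 T : R, 0 <= T &
  \forall i \near F,
    \int[jordan_pos (hahn_pairP (c i))]_x (Num.max (h x - T) 0 : R) <= e /\
    \int[jordan_neg (hahn_pairP (c i))]_x (Num.max (h x - T) 0 : R) <= e.

Let hT_continuous (T : R) : continuous (fun x => Num.max (h x - T) 0).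
Proof.
move=> x; apply: (@continuous_max R X (fun x => h x - T) (cst 0)).
  by apply: cvgB; [exact: h_continuous|exact: cvg_cst].
exact: cvg_cst.
Qed.

Let hT_le (T : R) x : 0 <= T -> `|Num.max (h x - T) 0| <= h x.
Proof.
move=> T0; rewrite ger0_norm ?le_max ?lexx ?orbT// ge_max h_ge0 andbT.
by rewrite gerBl.
Qed.

(** The excess over [T] is continuous and nonnegative, so its bound passes to the limit; [h] is then
    integrable because it is at most [T] plus the excess and the limit is finite. *)
Let hT_limit (m : I -> fmeas) (n : fmeas) (T e : R) : 0 <= T ->
  tight_weak_limit F m n ->
  (\forall i \near F, (m i).-integrable setT (EFin \o (h : borel X -> R))) ->
  (\forall i \near F, \int[m i]_x (Num.max (h x - T) 0 : R) <= e) ->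
  n.-integrable setT (EFin \o (h : borel X -> R)) /\
  \int[n]_x (Num.max (h x - T) 0 : R) <= e.
Proof.
move=> T0 [wcvg _ _] ih ihe.
have hT0 x : 0 <= Num.max (h x - T) 0 by rewrite le_max lexx orbT.
have [iT iTe] : n.-integrable setT
      (EFin \o ((fun x => Num.max (h x - T) 0) : borel X -> R)) /\
    \int[n]_x (Num.max (h x - T) 0) <= e.
  apply: (weak_limit_integral_le wcvg (@hT_continuous T) hT0).
  near=> i; split; last by near: i.
  have : (m i).-integrable setT (EFin \o (h : borel X -> R)) by near: i.
  apply: le_integrable => //.
    by apply/measurable_EFinP; exact: continuous_borel_measurable.
  by move=> x _; rewrite /= lee_fin (le_trans (hT_le x T0))// ler_norm.
split => //.
have := integrableD measurableT (finite_measure_integrable_cst n T measurableT) iT.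
apply: le_integrable => //.
  by apply/measurable_EFinP; exact: continuous_borel_measurable.
move=> x _ /=; rewrite lee_fin ger0_norm//.
rewrite (le_trans _ (ler_norm _))// maxEle; case: ifPn; rewrite -?ltNge; lra.
Unshelve. all: by end_near. Qed.

Let int_pos : \forall i \near F, (jordan_pos (hahn_pairP (c i))).-integrable
  setT (EFin \o (h : borel X -> R)).
Proof. by apply: filterS h_int => i /charge_integrableP[]. Qed.

Let int_neg : \forall i \near F, (jordan_neg (hahn_pairP (c i))).-integrable
  setT (EFin \o (h : borel X -> R)).
Proof. by apply: filterS h_int => i /charge_integrableP[]. Qed.

Let limit_integrable : a.-integrable setT (EFin \o (h : borel X -> R)) /\
  b.-integrable setT (EFin \o (h : borel X -> R)).
Proof.
have [T T0 Te] := h_unif ltr01.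
split.
  apply: (proj1 (@hT_limit _ _ T 1 T0 cvg_pos int_pos _)).
  by apply: filterS Te => i [].
apply: (proj1 (@hT_limit _ _ T 1 T0 cvg_neg int_neg _)).
by apply: filterS Te => i [].
Qed.

Lemma signed_limit_integrable : charge_integrable nu h.
Proof.
have [ia ib] := limit_integrable.
have [leP leN] := jordan_le_difference (fin_num_measure b) nuE.
apply/charge_integrableP; split.
  exact: dominated_integrable leP ia.
exact: dominated_integrable leN ib.
Qed.

(** No absolute value is needed, as the norms are suprema of the signed integrals. Each Jordan part
    contributes [e / 2]. *)
Lemma signed_uniform_cvg (p : X -> X -> R) (e : R) : pseudometric p ->
  (forall x, continuous (p x)) -> 0 < e ->
  \forall i \near F, forall f, Lip1 p f -> (forall x, `|f x| <= h x) ->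
    (charge_integral (csub (c i) nu) f <= e%:E)%E.
Proof.
move=> pp pc e0; have e20 : 0 < e / 2 by lra.
have [ia ib] := limit_integrable.
have ucvg (m : I -> fmeas) (n : fmeas) : tight_weak_limit F m n ->
    (\forall i \near F, (m i).-integrable setT (EFin \o (h : borel X -> R))) ->
    n.-integrable setT (EFin \o (h : borel X -> R)) ->
    (forall e' : R, 0 < e' -> exists2 T : R, 0 <= T & \forall i \near F,
      \int[m i]_x (Num.max (h x - T) 0 : R) <= e') ->
    \forall i \near F, forall f, Lip1 p f -> (forall x, `|f x| <= h x) ->
      `|\int[m i]_x (f x) - \int[n]_x (f x)| <= e / 2.
  move=> mn; have [wcvg [C mC nC] mtight] := mn => im inn unif.
  apply: (Lip1_uniform_cvg X_hausdorff pp pc wcvg mC nC mtight) => //.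
  move=> e' e'0; have [T T0 mT] := unif _ e'0.
  by exists T; split => //; exact: (proj2 (hT_limit T0 mn im mT)).
(* The [n] are integrals against the Jordan parts of [nu], the [y] against [a] and [b]; only their
   differences agree. *)
have arith (x1 x2 y1 y2 n1 n2 : R) : n1 - n2 = y1 - y2 ->
    `|x1 - y1| <= e / 2 -> `|x2 - y2| <= e / 2 -> x1 - n1 - (x2 - n2) <= e.
  by rewrite !ler_norml; lra.
near=> i => f fp fh.
have cf := Lip1_continuous pp pc fp.
have ich : charge_integrable (c i) h by near: i.
have icf := charge_integrable_le cf fh ich.
have inf := charge_integrable_le cf fh signed_limit_integrable.
have mf : measurable_fun setT (f : borel X -> R).
  exact: continuous_borel_measurable.
have le_int (n : fmeas) : n.-integrable setT (EFin \o (h : borel X -> R)) ->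
    n.-integrable setT (EFin \o (f : borel X -> R)).
  apply: le_integrable => //; first exact/measurable_EFinP.
  by move=> x _ /=; rewrite lee_fin (le_trans (fh x))// ler_norm.
have := @charge_integral_difference _ _ _ nu a b f (fin_num_measure a)
  (fin_num_measure b) nuE (le_int _ ia) (le_int _ ib).
rewrite charge_integral_jordan// => -[nuf].
rewrite charge_integral_csub// lee_fin.
have H1 : `|\int[jordan_pos (hahn_pairP (c i))]_x (f x) - \int[a]_x (f x)| <= e / 2.
  move: (f) fp fh {cf icf inf mf le_int nuf}; near: i; apply: ucvg => //.
  move=> e' /h_unif[T T0 Te]; exists T => //; by apply: filterS Te => ? [].
have H2 : `|\int[jordan_neg (hahn_pairP (c i))]_x (f x) - \int[b]_x (f x)| <= e / 2.
  move: (f) fp fh {cf icf inf mf le_int nuf H1}; near: i; apply: ucvg => //.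
  move=> e' /h_unif[T T0 Te]; exists T => //; by apply: filterS Te => ? [].
exact: (arith _ _ _ _ _ _ nuf H1 H2).
Unshelve. all: by end_near. Qed.

Lemma signed_mass_cvg (e : R) : 0 < e ->
  \forall i \near F, (`|csub (c i) nu setT| <= e%:E)%E.
Proof.
move=> e0; have e20 : 0 < e / 2 by lra.
have c1 : continuous (cst 1 : X -> R) by move=> x; exact: cvg_cst.
have o1 x : 0 <= (cst 1 : X -> R) x <= 1 by rewrite /= ler01 lexx.
have mass (m : I -> fmeas) (n : fmeas) : tight_weak_limit F m n ->
    \forall i \near F, `|fine (n setT) - fine (m i setT)| <= e / 2.
  move=> [wcvg _ _]; have /cvgrPdist_le /(_ _ e20) := wcvg _ c1 o1.
  by apply: filterS => i; rewrite !Rintegral_cst// !mul1r.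
have arith (x1 x2 n1 n2 : R) : `|n1 - x1| <= e / 2 ->
    `|n2 - x2| <= e / 2 -> `|x1 - x2 - (n1 - n2)| <= e.
  by rewrite !ler_norml; lra.
near=> i.
have H1 : `|fine (a setT) - fine (jordan_pos (hahn_pairP (c i)) setT)| <= e / 2.
  by near: i; exact: mass cvg_pos.
have H2 : `|fine (b setT) - fine (jordan_neg (hahn_pairP (c i)) setT)| <= e / 2.
  by near: i; exact: mass cvg_neg.
have -> : csub (c i) nu setT =
    (fine (jordan_pos (hahn_pairP (c i)) setT) -
     fine (jordan_neg (hahn_pairP (c i)) setT) -
     (fine (a setT) - fine (b setT)))%:E.
  rewrite !EFinB !fineK ?fin_num_measure// -nuE//.
  rewrite /csub/= /cadd/= /copp/= (jordan_decomp (hahn_pairP (c i)))//.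
  by rewrite /cadd/= cscaleN1.
by rewrite /= lee_fin; exact: arith H1 H2.
Unshelve. all: by end_near. Qed.

End signed_uniform_convergence.

End charge_convergence.

(** * Kantorovich gauges and uniform integrability *)

Section dual_gauge.
Context {R : realType} {X : ptopologicalType} {T : Type}.
Variables (c : T -> radon_measure R X) (W : set (X -> R)).
Hypothesis W0 : W (cst 0).
Hypothesis WN : forall f, W f -> W (fun x => - f x).
Hypothesis W_int : forall t f, W f -> charge_integrable (c t) f.
Local Open Scope ereal_scope.

Let J t (f : borel X -> R) : R :=
  (\int[jordan_pos (hahn_pairP (c t))]_x f x -
   \int[jordan_neg (hahn_pairP (c t))]_x f x)%R.

Let D s t := ereal_sup [set charge_integral (csub (c s) (c t)) f | f in W].

Let DE s t f : W f ->
  charge_integral (csub (c s) (c t)) f = (J s f - J t f)%:E.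
Proof.
move=> Wf; rewrite charge_integral_csub; [|exact: W_int..].
by rewrite /J !opprD !opprK addrACA.
Qed.

Let JN t f : W f -> J t (fun x => - f x)%R = (- J t f)%R.
Proof.
move=> /(@W_int t)/charge_integrableP[iP iN]; rewrite /J.
have NE (m : {finite_measure set (borel X) -> \bar R}) :
    m.-integrable setT (EFin \o (f : borel X -> R)) ->
    (\int[m]_x (- f x) = - \int[m]_x f x)%R.
  move=> im; rewrite -mulN1r -RintegralZl//.
  by apply: eq_Rintegral => x _; rewrite mulN1r.
by rewrite !NE// opprB opprK addrC.
Qed.

Let D_ub s t f : W f -> (J s f - J t f)%:E <= D s t.
Proof. by move=> Wf; rewrite -DE//; apply: ereal_sup_ubound; exists f. Qed.

Let D_lub s t y : (forall f, W f -> (J s f - J t f)%:E <= y) -> D s t <= y.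
Proof. by move=> Wy; apply: ge_ereal_sup => _ [f Wf <-]; rewrite DE// Wy. Qed.

Let Dge0 s t : 0 <= D s t.
Proof.
apply: le_trans (D_ub s t W0); rewrite /J /Rintegral.
by rewrite !integral0 !fine0 !subrr.
Qed.

Let D_sym_le s t : D s t <= D t s.
Proof.
apply: D_lub => f Wf; apply: le_trans (D_ub t s (WN Wf)).
by rewrite !JN// opprK addrC.
Qed.

(** Integrability of the functions in [W] turns the integral against a difference into
    [J s f - J t f]; a supremum of such differences over a class containing 0 and closed under
    negation is a pseudometric, possibly infinite. *)
Lemma dual_gaugeP : [/\ forall s t, 0 <= D s t, forall s, D s s = 0,
  forall s t, D s t = D t s & forall s t u, D s u <= D s t + D t u].
Proof.
split=> [s t|s|s t|s t u]; first exact: Dge0.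
- apply/eqP; rewrite eq_le Dge0 andbT; apply: D_lub => f Wf.
  by rewrite subrr.
- by apply/le_anti/andP; split; exact: D_sym_le.
- apply: D_lub => f Wf; apply: le_trans (leeD (D_ub s t Wf) (D_ub t u Wf)).
  by rewrite -EFinD lee_fin addrA subrK.
Qed.

Lemma dual_mass_gaugeP (E := fun s t => D s t + `|csub (c s) (c t) setT|) :
  [/\ forall s t, 0 <= E s t, forall s, E s s = 0,
  forall s t, E s t = E t s & forall s t u, E s u <= E s t + E t u].
Proof.
have [D0 Dxx DC Dtri] := dual_gaugeP.
pose M t : R := fine (c t setT).
have ME s t : `|csub (c s) (c t) setT| = (`|M s - M t|%R)%:E.
  by rewrite /M -abse_EFin EFinB !fineK ?fin_num_measure.
split=> [s t|s|s t|s t u].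
- by apply: adde_ge0; [exact: D0|exact: abse_ge0].
- by rewrite /E Dxx ME subrr normr0 adde0.
- by rewrite /E DC !ME distrC.
- rewrite /E addeACA; apply: leeD => //.
  by rewrite !ME -EFinD lee_fin ler_distD.
Qed.

End dual_gauge.

Section uniform_integrability.
Context {R : realType} {X : ptopologicalType}.
Variables (p : X -> X -> R).
Hypothesis p_pseudometric : pseudometric p.
Hypothesis p_continuous : forall a, continuous (p a).
Implicit Types (mu : {charge set (borel X) -> \bar R}).

Lemma pseudometric_continuous_l (x0 : X) : continuous (p^~ x0).
Proof.
have [_ _ pC _] := p_pseudometric.
by rewrite (_ : p^~ x0 = p x0) //; apply/funext => x; rewrite pC.
Qed.

Lemma pseudometric_integrable mu (x0 x1 : X) :
  charge_integrable mu (p^~ x1) -> charge_integrable mu (p^~ x0).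
Proof.
have [p0 _ _ ptri] := p_pseudometric.
have shift (m : {finite_measure set (borel X) -> \bar R}) :
    m.-integrable setT (EFin \o (p^~ x1 : borel X -> R)) ->
    m.-integrable setT (EFin \o (p^~ x0 : borel X -> R)).
  move=> i1; have := integrableD measurableT i1
    (finite_measure_integrable_cst m (p x1 x0) measurableT).
  apply: le_integrable => //.
    apply/measurable_EFinP; apply: continuous_borel_measurable.
    exact: pseudometric_continuous_l.
  by move=> x _ /=; rewrite lee_fin !ger0_norm ?addr_ge0.
by move=> /charge_integrableP[/shift iP /shift iN]; apply/charge_integrableP.
Qed.

(** Changes both the base point and the form of the condition: tails around [x1], a point that may
    vary with [p], become continuous excesses around the fixed [x0]. *)
Lemma uniformly_integrable_excess (S : set (radon_measure R X)) (x0 x1 : X) :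
  uniformly_integrable_at S p x1 ->
  S `<=` (fun mu : radon_measure R X => charge_integrable mu (p^~ x0)) ->
  forall e : R, 0 < e -> exists2 T : R, 0 <= T &
    forall mu : radon_measure R X, S mu ->
    \int[jordan_pos (hahn_pairP mu)]_x (Num.max (p x x0 - T) 0 : R) <= e /\
    \int[jordan_neg (hahn_pairP mu)]_x (Num.max (p x x0 - T) 0 : R) <= e.
Proof.
have [p0 _ _ ptri] := p_pseudometric => ui Si e e0.
pose tail (mu : radon_measure R X) (r : R) :=
  (\int[variation_measure mu]_(x in [set x | (r <= p x x1)%R]) (p x x1)%:E)%E.
have [r r0 re] : exists2 r : R, 0 <= r &
    forall mu : radon_measure R X, S mu -> (tail mu r <= e%:E)%E.
  have : \forall r \near +oo, (ereal_sup (0%E |`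
      [set tail mu r | mu in S]) < e%:E)%E.
    by apply: (ui [set y | (y < e%:E)%E]); apply: open_nbhs_nbhs;
      split; [exact: open_ereal_lt_ereal|rewrite /= lte_fin].
  move=> /(filterI (nbhs_pinfty_ge (num_real 0))) /filter_ex[r [/= r0 re]].
  exists r => // mu Smu; apply: le_trans (ltW re).
  by apply: ereal_sup_ubound; right; exists mu.
(* By the triangle inequality the excess over this level is at most the positive part of
   [p x x1 - r]: it vanishes where [p x x1 < r] and is at most [p x x1] elsewhere. *)
exists (r + p x1 x0); first by rewrite addr_ge0.
pose g (x : X) := Num.max (p x x0 - (r + p x1 x0)) 0.
have cg : continuous g.
  move=> x; apply: (@continuous_max R X (fun x => p x x0 - (r + p x1 x0)) (cst 0)).
    apply: cvgB; last exact: cvg_cst.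
    exact: pseudometric_continuous_l.
  exact: cvg_cst.
have mg : measurable_fun setT (g : borel X -> R).
  exact: continuous_borel_measurable.
have g0 x : 0 <= g x by rewrite /g le_max lexx orbT.
have gp x : `|g x| <= p x x0.
  rewrite ger0_norm// /g ge_max p0 andbT.
  by have := p0 x1 x0; lra.
have mp : measurable_fun setT ((fun x => p x x1) : borel X -> R).
  by apply: continuous_borel_measurable; exact: pseudometric_continuous_l.
have mset : @measurable _ (borel X) [set x | r <= p x x1].
  have := mp measurableT _ (measurable_itv `[r, +oo[); rewrite setTI.
  by congr measurable; apply/seteqP; split => x; rewrite /= in_itv/= andbT.
move=> mu Smu.
have main (m : {finite_measure set (borel X) -> \bar R}) :
    (forall A, measurable A -> (m A <= variation_measure mu A)%E) ->
    \int[m]_x (g x) <= e.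
  move=> mle.
  have img : m.-integrable setT (EFin \o (g : borel X -> R)).
    apply: dominated_integrable mle _.
    exact: charge_integrable_le cg gp (Si _ Smu).
  rewrite -lee_fin /Rintegral fineK; last exact: integrable_fin_num.
  apply: le_trans (re mu Smu); rewrite /tail [leRHS]integral_mkcond.
  apply: (@le_trans _ _ (\int[variation_measure mu]_x (g x)%:E)%E).
    apply: (ge0_le_measure_integral mle measurableT).
      by move=> x; rewrite lee_fin.
    exact/measurable_EFinP.
  apply: ge0_le_integral => //.
  - by move=> x _; rewrite lee_fin.
  - exact/measurable_EFinP.
  - by apply/(measurable_restrictT _ mset); apply/measurable_funTS/measurable_EFinP.
  - move=> x _; have := ptri x x1 x0; have := p0 x x1.
    have [rx|rx] := leP r (p x x1).
      by rewrite /patch mem_set// lee_fin /g ge_max => ? ?; lra.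
    rewrite /patch memNset/=; last by apply/negP; rewrite -ltNge.
    by rewrite lee_fin /g ge_max lexx andbT => ? ?; lra.
split; apply: main => A mA.
  by rewrite /variation_measure/= /charge_variation leeDl.
by rewrite /variation_measure/= /charge_variation leeDr.
Qed.

End uniform_integrability.

Lemma generates_continuous (R : realType) (X : ptopologicalType)
    (Pi : set (X -> X -> R)) (p : X -> X -> R) (a : X) :
  generates Pi -> Pi p -> pseudometric p -> continuous (p a).
Proof.
move=> gen Pip [p0 pxx pC ptri] x; apply/cvgrPdist_lt => e e0.
have : nbhs x [set y | p x y < e].
  apply: open_nbhs_nbhs; split; last by rewrite /= pxx.
  rewrite gen; apply: sub_gen_smallest; by exists p, x, e.
apply: filterS => y /= xy; apply: le_lt_trans xy.
have := ptri a x y; have := ptri a y x; rewrite (pC y x) ler_norml; lra.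
Qed.

Unset Implicit Arguments.
Set Strict Implicit.

Theorem proposition2p5 (R : realType) (X : ptopologicalType)
    (Pi : set (X -> X -> R))
    (X_completely_regular : completely_regular_space X)
    (X_hausdorff : hausdorff_space X)
    (Pi_pseudometric : forall p, Pi p -> pseudometric p)
    (Pi_generates : generates Pi)
    (S : set (radon_measure R X))
    (S_bounded : bounded_in_variation S)
    (S_tight : uniformly_tight S) :
  compact (closure (S : set (tau_KR Pi))) /\
  (S `<=` radon_Pi Pi ->
   (forall p, Pi p -> exists x0 : X, uniformly_integrable_at S p x0) ->
   forall x0 : X, exists2 C : set (tau_K Pi x0),
     compact C & S `<=` val @` (C : set (radon_Pi Pi))).
Proof.
have pc p : Pi p -> forall a, continuous (p a).
  by move=> Pip a; exact: (generates_continuous Pi_generates Pip (Pi_pseudometric p Pip)).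
split.
  pose P := [set D : radon_measure R X -> radon_measure R X -> \bar R |
    exists2 p, Pi p & D = fun nu mu => KR_norm p (csub nu mu)].
  have BE : [set A | exists p (mu : radon_measure R X) (r : R), Pi p /\
        A = [set nu : radon_measure R X | (KR_norm p (csub nu mu) < r%:E)%E]] =
      [set A | exists D x (r : R), P D /\ A = [set y | (D y x < r%:E)%E]].
    apply/seteqP; split => A /=.
      move=> [p [mu [r [Pip ->]]]]; exists (fun nu mu => KR_norm p (csub nu mu)), mu, r.
      by split => //; exists p.
    by move=> [D [mu [r [[p Pip ->] ->]]]]; exists p, mu, r.
  have int1 p : Pi p -> forall (mu : radon_measure R X) f,
      (Lip1 p f /\ forall x, `|f x| <= 1) -> charge_integrable mu f.
    move=> Pip mu f [fp f1].
    have cf := Lip1_continuous (Pi_pseudometric p Pip) (pc p Pip) fp.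
    apply: (charge_integrable_le (h := cst 1)) cf f1 _.
    by apply/charge_integrableP; split; exact: finite_measure_integrable_cst.
  rewrite /tau_KR BE; apply: gauge_compact_closure.
    move=> _ [p Pip ->]; have [p0 _ _ _] := Pi_pseudometric p Pip.
    apply: dual_gaugeP.
    - by split=> [x y|x]; rewrite /= ?subrr normr0 ?ler01.
    - by move=> f [fp f1]; split=> [x y|x]; rewrite ?normrN// -opprD normrN.
    - by move=> mu f; exact: int1.
  move=> F FU FS.
  have [nu [a [b [nuE la lb]]]] :=
    @ultra_signed_limit _ _ _ F id S FU X_hausdorff S_bounded S_tight FS.
  exists nu => _ [p Pip ->] e e0; have e20 : 0 < e / 2 by lra.
  have c1 : continuous (cst 1 : X -> R) by move=> x; exact: cvg_cst.
  have : \forall i \near F, forall f, Lip1 p f ->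
      (forall x, `|f x| <= (cst 1 : X -> R) x) ->
      (charge_integral (csub (i : radon_measure R X) nu) f <= (e / 2)%:E)%E.
    apply: (signed_uniform_cvg X_hausdorff nuE la lb c1) => //.
    - by apply: nearW => mu; apply/charge_integrableP; split;
        exact: finite_measure_integrable_cst.
    (* With the envelope 1, truncation at height 1 leaves no excess. *)
    - move=> e' e'0; exists 1 => //; apply: nearW => mu.
      have z (x : borel X) : Num.max ((cst 1 : X -> R) x - 1) 0 = 0.
        by rewrite /= subrr maxxx.
      by split; under eq_Rintegral do rewrite z;
        rewrite Rintegral_cst// mul0r ltW.
    - exact: Pi_pseudometric.
    - exact: pc.
  apply: filterS => mu muf /=; apply: (@le_lt_trans _ _ (e / 2)%:E).
    by apply: ge_ereal_sup => _ [f [fp f1] <-]; exact: muf.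
  by rewrite lte_fin; lra.
move=> SPi Sui x0.
pose c (t : radon_Pi Pi) : radon_measure R X := val t.
pose P := [set D : radon_Pi Pi -> radon_Pi Pi -> \bar R |
  exists2 p, Pi p & D = fun nu mu => K_norm x0 p (csub (c nu) (c mu))].
have BE : [set A | exists p (mu : radon_Pi Pi) (r : R), Pi p /\
      A = [set nu : radon_Pi Pi | (K_norm x0 p (csub (val nu) (val mu)) < r%:E)%E]] =
    [set A | exists D x (r : R), P D /\ A = [set y | (D y x < r%:E)%E]].
  apply/seteqP; split => A /=.
    move=> [p [mu [r [Pip ->]]]].
    exists (fun nu mu => K_norm x0 p (csub (c nu) (c mu))), mu, r.
    by split => //; exists p.
  by move=> [D [mu [r [[p Pip ->] ->]]]]; exists p, mu, r.
(* Membership in [radon_Pi] supplies its own base point; integrability is transported to the [x0] of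
   [tau_K]. *)
have intp mu : radon_Pi Pi mu -> forall p, Pi p -> charge_integrable mu (p^~ x0).
  move=> [x1 mux1] p Pip.
  have i1 : charge_integrable mu (p^~ x1) by exact: mux1.
  exact: (pseudometric_integrable (Pi_pseudometric p Pip) (pc p Pip) x0 i1).
have Lip1_le p f : Pi p -> Lip1 p f -> f x0 = 0 -> forall x, `|f x| <= p x x0.
  by move=> Pip fp fx0 x; rewrite -[f x]subr0 -fx0.
rewrite /tau_K BE.
(* The closure is taken inside the subtype [radon_Pi Pi], so the limit of each ultrafilter must be
   shown to belong to it. *)
exists (closure (c @^-1` S : set (coarsest
  [set A | exists D x (r : R), P D /\ A = [set y | (D y x < r%:E)%E]]))); last first.
  move=> mu Smu; exists (SigSub (mem_set (SPi mu Smu))) => //.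
  exact: subset_closure.
apply: gauge_compact_closure.
  move=> _ [p Pip ->]; apply: dual_mass_gaugeP.
  - split=> [x y|//]; rewrite /= subrr normr0.
    by have [p0 _ _ _] := Pi_pseudometric p Pip.
  - move=> f [fp fx0]; split=> [x y|]; last by rewrite fx0 oppr0.
    by rewrite -opprD normrN.
  - move=> t f [fp fx0].
    have cf := Lip1_continuous (Pi_pseudometric p Pip) (pc p Pip) fp.
    apply: charge_integrable_le cf (Lip1_le p f Pip fp fx0) _.
    by apply: intp => //; exact: set_valP.
move=> F FU FS.
have [nu [a [b [nuE la lb]]]] :=
  @ultra_signed_limit _ _ _ F c S FU X_hausdorff S_bounded S_tight FS.
have pcl p : Pi p -> continuous (p^~ x0).
  by move=> Pip; exact: (@pseudometric_continuous_l _ _ p (Pi_pseudometric p Pip) (pc p Pip)).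
have p0 p : Pi p -> forall x, 0 <= p x x0.
  by move=> Pip x; have [+ _ _ _] := Pi_pseudometric p Pip; apply.
have intF p : Pi p -> \forall i \near F, charge_integrable (c i) (p^~ x0).
  by move=> Pip; apply: nearW => i; apply: intp => //; exact: set_valP.
have unifF p : Pi p -> forall e : R, 0 < e -> exists2 T : R, 0 <= T &
    \forall i \near F,
    \int[jordan_pos (hahn_pairP (c i))]_x (Num.max (p x x0 - T) 0 : R) <= e /\
    \int[jordan_neg (hahn_pairP (c i))]_x (Num.max (p x x0 - T) 0 : R) <= e.
  move=> Pip e e0; have [x1 ui] := Sui p Pip.
  have [|T T0 Te] := uniformly_integrable_excess (Pi_pseudometric p Pip)
    (pc p Pip) (x0 := x0) ui _ e0.
    by move=> mu /SPi muPi; exact: intp.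
  by exists T => //; apply: filterS FS => i /Te.
(* The limit has integrable pseudometrics because the excesses around [x0] are uniformly small along
   [F]. *)
have nuPi : radon_Pi Pi nu.
  exists x0 => p Pip.
  suff : charge_integrable nu (p^~ x0) by [].
  exact: (signed_limit_integrable nuE la lb (pcl p Pip) (p0 p Pip) (intF p Pip)
    (unifF p Pip)).
exists (SigSub (mem_set nuPi)) => _ [p Pip ->] e e0.
have e30 : 0 < e / 3 by lra.
have FF : ProperFilter F by exact: ultra_proper.
have lip := signed_uniform_cvg (FF := FF) X_hausdorff nuE la lb (pcl p Pip) (p0 p Pip)
  (intF p Pip) (unifF p Pip) (Pi_pseudometric p Pip) (pc p Pip) e30.
have mass := signed_mass_cvg (FF := FF) nuE la lb e30.
apply: (filterS2 _ _ lip mass) => i ilip imass /=.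
(* One third each for the supremum and for the mass term; the last third makes the inequality
   strict. *)
apply: (@le_lt_trans _ _ ((e / 3)%:E + (e / 3)%:E)%E).
  apply: leeD; last exact: imass.
  apply: ge_ereal_sup => _ [f [fp fx0] <-].
  by apply: ilip => //; exact: Lip1_le.
by rewrite -EFinD lte_fin; lra.
Qed.
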